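(* Suppose that $(G,N,\theta)_{\mathcal H}$ and $(H,M,\varphi)_{\mathcal H}$ are $\mathcal H$-triples such that $G=NH$, $N\cap H=M$ and $(\mathcal H\times H)_\theta=(\mathcal H\times H)_\varphi$. Let $K\le N$ and $Z\le M$ be subgroups with $Z=K\cap H$. Let $\chi\in\mathrm{IBr}(K)$ and $\lambda\in\mathrm{IBr}(Z)$ be such that the induced characters satisfy $\chi^N=\theta$, $\lambda^M=\varphi$, and such that $N_\chi=K$, $M_\lambda=Z$. Let $\ast\in\{\emptyset,c,b\}$. Suppose that $$(G_{\chi^{\mathcal H}},K,\chi)_{\mathcal H}\geqslant_\ast(H_{\lambda^{\mathcal H}},Z,\lambda)_{\mathcal H}$$ and that $(\mathcal H\times H)_\varphi=(\mathcal H\times H)_\lambda M$. Then $$(G,N,\theta)_{\mathcal H}\geqslant_\ast(H,M,\varphi)_{\mathcal H}.$$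
   Context: **Setup.** Throughout, $p$ is a fixed prime and all groups are finite. $(\mathcal K,\mathcal O,F)$ is a $p$-modular system ($\mathcal O$ a complete discrete valuation ring, $\mathcal K$ its fraction field of characteristic $0$, $F$ its residue field of characteristic $p$), with $F$ finite, sufficiently large for all groups considered (all group algebras split over $\mathcal K$ and $F$). $\mathcal H\le\mathrm{Aut}(\mathcal K)$ is a fixed finite abelian group of automorphisms preserving $\mathcal O$, hence acting on $F$, and mapping onto $\mathrm{Aut}(F)$; the action is written $x\mapsto x^\sigma$. ''Character'' means Brauer character; $\mathrm{IBr}(X)$ is the set of irreducible Brauer characters of $X$. If $X,B\le A$, $\chi$ is a character of $X$ and $a=(\sigma,g)\in\mathcal H\times A$, put $X^a=g^{-1}Xg$ and $\chi^a(x)=\chi(gxg^{-1})^\sigma$, a character of $X^a$. Subscripts denote stabilizers: $(\mathcal H\times B)_\chi=\{a\in\mathcal H\times B: X^a=X,\ \chi^a=\chi\}$, $B_\chi=\{g\in B: X^g=X,\ \chi^g=\chi\}$, and $B_{\chi^{\mathcal H}}=\{g\in B: X^g=X,\ \chi^g=\chi^\sigma\text{ for some }\sigma\in\mathcal H\}$. In $(\mathcal H\times H)_\lambda M$ the group $M$ is viewed as $1\times M\le\mathcal H\times H$. **Projective representations.** A projective representation $\mathcal P:G\to\mathrm{GL}_m(F)$ satisfies $\mathcal P(1)=I_m$ and $\mathcal P(g)\mathcal P(h)=\alpha(g,h)\mathcal P(gh)$ with factor set $\alpha:G\times G\to F^\times$. Two such maps are similar ($\sim$) if they are conjugate by a fixed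 invertible matrix. If $N\unlhd G$ and $\theta\in\mathrm{IBr}(N)$ is $G$-invariant, $\mathcal P:G\to\mathrm{GL}_{\theta(1)}(F)$ is associated with $\theta$ if $\mathcal P|_N$ is a representation affording $\theta$ and $\mathcal P(g)\mathcal P(n)=\mathcal P(gn)$, $\mathcal P(n)\mathcal P(g)=\mathcal P(ng)$ for all $n\in N,g\in G$. For $a=(\sigma,g)$, $\mathcal P^a(x)=\mathcal P(gxg^{-1})^\sigma$. For a subset $X$, $\mathcal P(X^+)=\sum_{x\in X}\mathcal P(x)$ ($0$ if $X=\emptyset$). $\mathrm{Cl}_J(x)$ is the $J$-conjugacy class of $x$. **$\mathcal H$-triples.** An $\mathcal H$-triple $(G,N,\theta)_{\mathcal H}$ consists of $N\le G$ and $\theta\in\mathrm{IBr}(N)$ with $G=G_{\theta^{\mathcal H}}$ (so $N\unlhd G$). If $\mathcal P$ is a projective representation of $G_\theta$ associated with $\theta$ and $a\in(\mathcal H\times G)_\theta$, there is a unique function $\mu_a:G_\theta\to F^\times$, constant on $N$-cosets, with $\mathcal P^a\sim\mu_a\mathcal P$. Let $(G,N,\theta)_{\mathcal H}$ and $(H,M,\varphi)_{\mathcal H}$ be $\mathcal H$-triples with $G=NH$, $M=N\cap H$ and $(\mathcal H\times H)_\theta=(\mathcal H\times H)_\varphi$ (so $G_\theta/N\cong H_\varphi/M$). Let $\mathcal P,\mathcal P'$ be projective representations of $G_\theta,H_\varphi$ associated with $\theta,\varphi$. - $(\mathcal P,\mathcal P')$ gives $(G,N,\theta)_{\mathcal H}\geqslant(H,M,\varphi)_{\mathcal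 H}$ (the case $\ast=\emptyset$) if the factor sets of $\mathcal P$ and $\mathcal P'$ agree under $G_\theta/N\cong H_\varphi/M$ and, for every $a\in(\mathcal H\times H)_\theta$, the functions $\mu_a,\mu_a'$ defined by $\mathcal P^a\sim\mu_a\mathcal P$, $\mathcal P'^a\sim\mu'_a\mathcal P'$ agree on $H_\varphi$. - It gives $\geqslant_c$ if in addition $C_G(N)\subseteq H$ and for every $c\in C_G(N)$ the scalar matrices $\mathcal P(c)$ and $\mathcal P'(c)$ have the same scalar. - It gives $\geqslant_b$ if it gives $\geqslant_c$ and, for every $x\in G_\theta$, the scalar matrices $\mathcal P(\mathrm{Cl}_{\langle N,x\rangle}(x)^+)$ and $\mathcal P'((\mathrm{Cl}_{\langle N,x\rangle}(x)\cap H)^+)$ have the same scalar. The relation $\geqslant_\ast$ holds if some pair $(\mathcal P,\mathcal P')$ gives it; stating it includes the group-theoretic conditions above. *)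

(* Defs.v *)
From HB Require Import structures.
From mathcomp Require Import all_boot all_order all_fingroup all_algebra.
From mathcomp Require Import all_solvable all_field all_character.
Set Implicit Arguments.
Unset Strict Implicit.
Unset Printing Implicit Defensive.
Import Order.TTheory GRing.Theory Num.Theory GroupScope.
Local Open Scope ring_scope.

(* Normalized discrete valuation of a field; the value at 0 is irrelevant
   (mathematically it is +oo). *)
Definition discrete_valuation (K : fieldType) (v : K -> int) : Prop :=
  [/\ forall x y, x != 0 -> y != 0 -> v (x * y) = v x + v y,
      forall x y, x != 0 -> y != 0 -> x + y != 0 ->
        Num.min (v x) (v y) <= v (x + y)
    & forall z : int, exists2 x, x != 0 & v x = z].

Definition val_ge (K : fieldType) (v : K -> int) (z : int) (x : K) : Prop :=
  x = 0 \/ z <= v x.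

(* emb identifies O with the valuation ring of a discrete valuation v of K,
   and O is complete for the topology defined by v. *)
Definition complete_dvr (O : idomainType) (K : fieldType)
    (emb : {rmorphism O -> K}) : Prop :=
  exists v : K -> int,
    [/\ discrete_valuation v,
        forall x, (exists a, emb a = x) <-> val_ge v 0 x
      & forall u : nat -> O,
          (forall z : int, exists k : nat, forall i j : nat,
             (k <= i)%N -> (k <= j)%N -> val_ge v z (emb (u i - u j))) ->
          exists l : O, forall z : int, exists k : nat, forall i : nat,
             (k <= i)%N -> val_ge v z (emb (u i - l))].

(* p-modular system (K, O, F) with F finite. The type pmO is embedded in pmK
   by pm_emb, and pm_red is reduction modulo the maximal ideal, i.e. the ideal
   of nonunits. *)
Record modular_system (p : nat) := ModularSystem {
  pmK : fieldType;
  pmO : idomainType;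
  pmF : finFieldType;
  pm_emb : {rmorphism pmO -> pmK};
  pm_red : {rmorphism pmO -> pmF};
  pm_emb_inj : injective pm_emb;
  pm_frac : forall x : pmK,
    exists a b : pmO, b != 0 /\ x = pm_emb a / pm_emb b;
  pm_cdvr : complete_dvr pm_emb;
  pm_red_surj : forall y : pmF, exists a, pm_red a = y;
  pm_red_ker : forall a, (pm_red a == 0) = (a \isn't a GRing.unit);
  pm_charK : [pchar pmK] =i pred0;
  pm_charF : p \in [pchar pmF] }.

(* A finite abelian subgroup of Aut(K), given as a finite group hT acting
   faithfully on K by field automorphisms on the right: autK s x is x^s.
   It preserves O, autF is the induced action on the residue field F, and it
   maps onto Aut(F). (Ring endomorphisms of the finite field F are
   automorphisms.) *)
Record automorphism_group (p : nat) (S : modular_system p)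
    (hT : finGroupType) := AutomorphismGroup {
  autK : hT -> {rmorphism pmK S -> pmK S};
  autF : hT -> {rmorphism pmF S -> pmF S};
  autK1 : forall x, autK 1%g x = x;
  autKM : forall s t x, autK (s * t)%g x = autK t (autK s x);
  autK_faithful : forall s, (forall x, autK s x = x) -> s = 1%g;
  aut_abelian : abelian [set: hT];
  aut_compat : forall s a,
    exists2 b, pm_emb S b = autK s (pm_emb S a)
             & pm_red S b = autF s (pm_red S a);
  autF_surj : forall f : {rmorphism pmF S -> pmF S},
    exists s, forall y, autF s y = f y }.

Section BrauerCharacters.

Variables (p : nat) (S : modular_system p) (gT : finGroupType).
Local Notation K := (pmK S).
Local Notation F := (pmF S).

(* A Brauer character of X is encoded as a function on the ambient group that
   vanishes off the set of p-regular elements of X. *)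
Definition brauer_fun := {ffun gT -> K}.

(* The value at a p-regular x is the sum of the lifts z of the eigenvalues of
   R x to roots of unity of order prime to p in O. *)
Definition affords_brauer (X : {set gT}) n (R : gT -> 'M[F]_n)
    (chi : brauer_fun) : Prop :=
  (forall x, x \in X -> (p^'.-elt x)%g -> exists s : seq (pmO S),
     [/\ forall z, z \in s -> exists2 m, coprime p m & z ^+ m = 1,
         char_poly (R x) = \prod_(z <- s) ('X - (pm_red S z)%:P)
       & chi x = \sum_(z <- s) pm_emb S z])
  /\ (forall x, ~~ ((x \in X) && (p^'.-elt x)%g) -> chi x = 0).

Definition IBr (X : {group gT}) (chi : brauer_fun) : Prop :=
  exists n (rX : mx_representation F X n),
    mx_irreducible rX /\ affords_brauer X rX chi.

(* Induction from X to Y; recall that chi vanishes off X. *)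
Definition brauer_Ind (Y X : {set gT}) (chi : brauer_fun) : brauer_fun :=
  [ffun y => #|X|%:R^-1 * \sum_(g in Y) chi (y ^ g)%g].

Definition splits_over_KF (G : {set gT}) : Prop :=
  forall X : {group gT}, X \subset G ->
    group_splitting_field K X /\ group_splitting_field F X.

End BrauerCharacters.

Section Triples.

Variables (p : nat) (S : modular_system p) (hT : finGroupType).
Variables (HH : automorphism_group S hT) (gT : finGroupType).
Local Notation F := (pmF S).
Local Notation bfun := (brauer_fun S gT).
Implicit Types (B X : {set gT}) (chi : bfun) (a : hT * gT).

(* chi^a (x) = chi (g x g^-1)^s for a = (s, g) *)
Definition bact chi a : bfun :=
  [ffun x => autK HH a.1 (chi (x ^ a.2^-1)%g)].

(* (H x B)_chi *)
Definition Hstab B X chi : {set hT * gT} :=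
  [set a in setX [set: hT] B | (X :^ a.2 == X) && (bact chi a == chi)].

(* B_chi *)
Definition stab B X chi : {set gT} :=
  [set g in B | (X :^ g == X) && (bact chi (1, g)%g == chi)].

(* B_{chi^H} *)
Definition orbstab B X chi : {set gT} :=
  [set g in B | (X :^ g == X) &&
     [exists s : hT, bact chi (1, g)%g == bact chi (s, 1)%g]].

Lemma bactM chi a b : bact (bact chi a) b = bact chi (a * b)%g.
Proof.
by apply/ffunP=> x; rewrite !ffunE /= autKM invMg conjgM.
Qed.

Lemma orbstab_group_set (B : {group gT}) X chi : group_set (orbstab B X chi).
Proof.
apply/group_setP; split=> [|g h].
  by rewrite inE group1 conjsg1 eqxx; apply/existsP; exists 1%g.
rewrite !inE => /and3P[Bg /eqP Xg /existsP[s /eqP gs]].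
move=> /and3P[Bh /eqP Xh /existsP[t /eqP ht]].
rewrite groupM //= conjsgM Xg Xh eqxx; apply/existsP; exists (t * s)%g.
apply/eqP.
have pairM (s1 t1 : hT) (g1 h1 : gT) :
  ((s1, g1) * (t1, h1) = (s1 * t1, g1 * h1))%g by [].
have <- : bact (bact chi (1, g)%g) (1, h)%g = bact chi (1, g * h)%g.
  by rewrite bactM pairM mul1g.
rewrite gs bactM pairM mulg1 mul1g.
have -> : bact chi (s, h) = bact (bact chi (1, h)%g) (s, 1%g).
  by rewrite bactM pairM mulg1 mul1g.
by rewrite ht bactM pairM mulg1.
Qed.

Canonical orbstab_group (B : {group gT}) X chi :=
  Group (orbstab_group_set B X chi).

Definition H_triple (G N : {group gT}) (theta : bfun) : Prop :=
  [/\ N \subset G, IBr N theta & G = orbstab G N theta :> {set gT}].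

(* Only the values of P on J, and those of its factor set alpha on J x J,
   are relevant. *)
Definition proj_repr (J : {set gT}) n (P : gT -> 'M[F]_n)
    (alpha : gT -> gT -> F) : Prop :=
  [/\ P 1%g = 1%:M,
      forall g, g \in J -> P g \in unitmx
    & forall g h, g \in J -> h \in J ->
        alpha g h != 0 /\ P g *m P h = alpha g h *: P (g * h)%g].

(* The degree n is forced to be theta(1), since P restricted to N affords
   theta. *)
Definition associated (J N : {set gT}) (theta : bfun) n (P : gT -> 'M[F]_n)
    (alpha : gT -> gT -> F) : Prop :=
  [/\ proj_repr J P alpha,
      mx_repr N P,
      affords_brauer N P theta
    & forall x g, x \in N -> g \in J ->
        P g *m P x = P (g * x)%g /\ P x *m P g = P (x * g)%g].

Definition similar_on (J : {set gT}) n (P Q : gT -> 'M[F]_n) : Prop :=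
  exists2 T : 'M[F]_n, T \in unitmx &
    forall x, x \in J -> P x = invmx T *m Q x *m T.

(* P^a (x) = P (g x g^-1)^s for a = (s, g) *)
Definition proj_act n (P : gT -> 'M[F]_n) a : gT -> 'M[F]_n :=
  fun x => map_mx (autF HH a.1) (P (x ^ a.2^-1)%g).

(* mu is the function J -> F^x, constant on N-cosets, with P^a ~ mu P. *)
Definition is_mu (J N : {set gT}) n (P : gT -> 'M[F]_n) a (mu : gT -> F)
    : Prop :=
  [/\ forall x, x \in J -> mu x != 0,
      forall x y, x \in J -> y \in N -> mu (x * y)%g = mu x
    & similar_on J (proj_act P a) (fun x => mu x *: P x)].

Section Gives.

Variables (G N : {group gT}) (theta : bfun) (H M : {group gT}) (phi : bfun).
Local Notation Gt := (stab G N theta).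
Local Notation Hp := (stab H M phi).
Variables (n m : nat) (P : gT -> 'M[F]_n) (P' : gT -> 'M[F]_m).

(* The isomorphism from Hp / M to Gt / N maps the coset u M to u N. *)
Definition gives : Prop :=
  exists alpha alpha' : gT -> gT -> F,
    [/\ associated Gt N theta P alpha,
        associated Hp M phi P' alpha',
        forall x y u v, x \in Gt -> y \in Gt -> u \in Hp -> v \in Hp ->
          x \in (u *: N)%g -> y \in (v *: N)%g -> alpha x y = alpha' u v
      & forall a, a \in Hstab H N theta ->
          exists mu mu' : gT -> F,
            [/\ is_mu Gt N P a mu, is_mu Hp M P' a mu'
              & forall x, x \in Hp -> mu x = mu' x]].

Definition gives_c : Prop :=
  [/\ gives, 'C_G(N)%g \subset H
    & forall c, c \in 'C_G(N)%g ->
        exists z : F, P c = z%:M /\ P' c = z%:M].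

Definition gives_b : Prop :=
  gives_c /\
  forall x, x \in Gt ->
    let C := (x ^: <<x |: N>>)%g in
    exists z : F,
      \sum_(y in C) P y = z%:M /\ \sum_(y in C :&: H) P' y = z%:M.

End Gives.

Inductive order_kind := OrderPlain | OrderCentral | OrderBlock.

Definition triple_ge (star : order_kind) (G N : {group gT}) (theta : bfun)
    (H M : {group gT}) (phi : bfun) : Prop :=
  [/\ H_triple G N theta, H_triple H M phi,
      G = (N * H)%g :> {set gT} /\ M = N :&: H :> {set gT},
      Hstab H N theta = Hstab H M phi
    & exists n m (P : gT -> 'M[F]_n) (P' : gT -> 'M[F]_m),
        match star with
        | OrderPlain => gives G N theta H M phi P P'
        | OrderCentral => gives_c G N theta H M phi P P'
        | OrderBlock => gives_b G N theta H M phi P P'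
        end].

End Triples.

(* Main.v *)
Require Import Defs.
From mathcomp Require Import all_boot all_order all_fingroup all_algebra.
From mathcomp Require Import all_solvable all_field all_character.
From Stdlib Require Import Classical.
Set Implicit Arguments.
Unset Strict Implicit.
Unset Printing Implicit Defensive.
Import Order.TTheory GRing.Theory Num.Theory GroupScope.
Local Open Scope ring_scope.

(* Let I and I' be the stabilizers of chi in G and of lambda in H. The hypotheses
   give G_theta = N I = N I' and H_phi = M I', with N :&: I = K and M :&: I' = Z,
   so the projective representations P and P' of I and I' induce to G_theta and
   H_phi: for a left transversal t of K in N, the (i, j) block of the induced map
   at x is P (t_i^-1 x t_j), or 0 when t_i^-1 x t_j is not in I. Factor sets and
   the functions mu are constant on cosets, hence extend from I to N I; the
   similarities extend because conjugation by an element of H changes t into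
   another transversal.

   On N the induced map is a representation affording chi^N: the eigenvalues of a
   p-regular x on an orbit of x of length r > 1 on N / K form cosets of the group
   of r-th roots of unity, so their lifts sum to 0, and only the fixed cosets
   contribute to the Brauer character.

   For the block order, the representation of N affording theta is absolutely
   irreducible, because its traces are those of an irreducible representation with
   the same Brauer character. By Schur's lemma the class sums of G_theta are then
   scalar, and the scalar is read off a diagonal block, where it is a sum of
   scalars of K-class sums. *)

(** * Traces and eigenbases *)

(** Over the polynomial ring, ['X - A] divides ['X ^+ k - A ^+ k = 'X ^+ k]. Taking determinants,
    [char_poly A] divides a power of ['X], hence is itself a power of ['X]. *)
Lemma mxtrace_nilpotent (F : fieldType) n (A : 'M[F]_n.+1) k :
  A ^+ k = 0 -> \tr A = 0.
Proof.
move=> Ak0; have dvdA: char_poly A %| ('X - 0%:P) ^+ (k * n.+1).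
  rewrite subr0; apply/dvdpP.
  pose B := map_mx polyC A : 'M[{poly F}]_n.+1.
  have cXB: GRing.comm (('X)%:M : 'M_n.+1) B.
    by rewrite /GRing.comm -!mulmxE scalar_mxC.
  exists (\det (\sum_(i < k) ('X%:M : 'M_n.+1) ^+ (k.-1 - i) * B ^+ i)).
  rewrite mulrC -det_mulmx /char_poly_mx mulmxE -subrXX_comm //.
  have Bk i : B ^+ i = map_mx polyC (A ^+ i).
    elim: i => [|i IHi]; first by rewrite !expr0 map_mx1.
    by rewrite !exprS IHi -!mulmxE map_mxM.
  have Xk i : ('X%:M : 'M[{poly F}]_n.+1) ^+ i = ('X ^+ i)%:M.
    elim: i => [|i IHi]; first by rewrite !expr0.
    by rewrite !exprS IHi -!mulmxE scalar_mxM.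
  by rewrite Bk Ak0 map_mx0 subr0 Xk det_scalar exprM.
have /dvdp_exp_XsubCP[j _ eqA] := dvdA.
have chA: char_poly A = 'X ^+ j.
  apply/eqP; rewrite -eqp_monic ?char_poly_monic ?monicXn //.
  by move: eqA; rewrite subr0.
have j_n: j = n.+1.
  by apply: succn_inj; rewrite -(size_polyXn F) -chA size_char_poly.
apply: oppr_inj; rewrite oppr0 -char_poly_trace // chA j_n coefXn.
by rewrite /= ltn_eqF.
Qed.

(** With [u] and [s] the [p]- and [p']-parts of [x], the difference
    [rG x - rG s = (rG u - 1) *m rG s] is nilpotent: the factors commute, and in characteristic [p]
    a power of Frobenius sends [rG u - 1] to [rG u ^+ #[u] - 1 = 0]. *)
Lemma mxtrace_repr_p'part (F : fieldType) (p : nat) (gT : finGroupType)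
    (G : {group gT}) n (rG : mx_representation F G n) x :
  p \in [pchar F] -> x \in G -> \tr (rG x) = \tr (rG (x.`_p^')%g).
Proof.
case: n rG => [|n] rG charF Gx.
  by rewrite [rG x]thinmx0 [rG _]thinmx0.
have Gxp: x.`_p \in G by rewrite groupX.
have Gxp': x.`_p^' \in G by rewrite groupX.
rewrite -[in LHS](consttC p x) repr_mxM //.
have cxx: rG x.`_p *m rG x.`_p^' = rG x.`_p^' *m rG x.`_p.
  rewrite -!repr_mxM //; congr (rG _).
  exact: commuteX2.
apply/eqP; rewrite -subr_eq0 -raddfB /= -{2}[rG x.`_p^']mul1mx -mulmxBl.
apply/eqP/(@mxtrace_nilpotent _ _ _ (#[x.`_p])).
have pn : p.-nat #[x.`_p] := p_elt_constt p x.
have c1: GRing.comm (rG x.`_p - 1%:M) (rG x.`_p^').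
  by apply: commr_sym; apply: commrB; [symmetry | exact: commr1].
have charM : p \in [pchar 'M[F]_n.+1].
  by rewrite !inE (pcharf_prime charF) -(rmorph_nat (@scalar_mx F n.+1))
     (pcharf0 charF) rmorph0 eqxx.
have xpK : rG x.`_p ^+ #[x.`_p] = 1.
  by rewrite -repr_mxX // expg_order repr_mx1.
rewrite mulmxE exprMn_comm //.
suff ->: (rG x.`_p - 1%:M) ^+ #[x.`_p] = 0 by rewrite mul0r.
have [k def_k] := p_natP pn; rewrite def_k in xpK *.
have FrobX j : (rG x.`_p - 1%:M) ^+ (p ^ j) = rG x.`_p ^+ (p ^ j) - 1.
  elim: j => [|j IHj]; first by rewrite !expr1.
  rewrite expnSr !exprM IHj -!(pFrobenius_autE charM).
  by rewrite pFrobenius_autB_comm ?pFrobenius_aut1 //; apply: commr1.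
by rewrite FrobX xpK subrr.
Qed.

Lemma char_poly_similar (F : fieldType) n (E A D : 'M[F]_n) :
  E \in unitmx -> E *m A = D *m E -> char_poly A = char_poly D.
Proof.
move=> uE EA.
have: (\det (map_mx polyC E)) * char_poly A = char_poly D * \det (map_mx polyC E).
  rewrite /char_poly /char_poly_mx -!det_mulmx mulmxBr mulmxBl.
  by rewrite -scalar_mxC -!map_mxM EA.
rewrite mulrC; apply: mulIf; rewrite det_map_mx polyC_eq0 -unitfE.
by rewrite -unitmxE.
Qed.

(** Spanning is expressed through the row spaces that contain every [v i], which can be checked
    block by block. A spanning family of [n] vectors is a basis. *)
Lemma char_poly_eigenbasis (F : fieldType) n (I : finType) (A : 'M[F]_n)
    (v : I -> 'rV[F]_n) (l : I -> F) :
  #|I| = n -> (forall i, v i *m A = l i *: v i) ->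
  (forall B : 'M[F]_n, (forall i, v i <= B)%MS -> row_full B) ->
  char_poly A = \prod_i ('X - (l i)%:P).
Proof.
move=> cI eigv spanv; pose f (i : 'I_n) : I := enum_val (cast_ord (esym cI) i).
have fK i : f (cast_ord cI (enum_rank i)) = i.
  by rewrite /f cast_ordK enum_rankK.
pose E := \matrix_(i < n) v (f i); pose D := diag_mx (\row_i l (f i)).
have uE: E \in unitmx.
  rewrite -row_full_unit; apply: spanv => i.
  by rewrite -(fK i) -(rowK (fun j => v (f j))) row_sub.
have EA: E *m A = D *m E.
  apply/row_matrixP=> i; rewrite !row_mul rowK eigv row_diag_mx mxE.
  by rewrite -scalemxAl -rowE rowK.
rewrite (char_poly_similar uE EA) char_poly_trig ?diag_mx_is_trig //.
rewrite [RHS](reindex f) /=.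
  by apply: eq_bigr => i _; rewrite !mxE eqxx mulr1n.
exists (fun i => cast_ord cI (enum_rank i)) => i _ //.
by rewrite /f enum_valK cast_ordKV.
Qed.

(** ['X ^+ m - 1] kills [A] and has distinct roots, the powers of [z], so [A] is diagonalizable. The
    power of [A] is written with [iter] to allow [n = 0]. *)
Lemma finite_order_eigenbasis (F : fieldType) (m : nat) (z : F) n (A : 'M[F]_n) :
  m.-primitive_root z -> iter m (mulmx A) 1%:M = 1%:M ->
  exists (w : 'I_n -> 'rV[F]_n) (e : 'I_n -> nat),
    (forall i, w i *m A = z ^+ e i *: w i)
    /\ forall B : 'M[F]_n, (forall i, w i <= B)%MS -> row_full B.
Proof.
case: n A => [|n] A prim_z Am1.
  exists (fun _ => 0), (fun _ => 0%N); split=> [[]|] // B _.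
  by rewrite -sub1mx [1%:M]thinmx0 sub0mx.
have {}Am1: A ^+ m = 1.
  rewrite -[RHS]Am1 {Am1}; elim: m {prim_z} => // k IHk.
  by rewrite exprS IHk.
have m_gt0 := prim_order_gt0 prim_z.
have dA: diagonalizable A.
  apply/diagonalizableP; exists [seq z ^+ val i | i <- enum 'I_m].
    rewrite map_inj_uniq ?enum_uniq // => i j /eqP.
    by rewrite (eq_prim_root_expr prim_z) !modn_small ?ltn_ord // => /eqP/val_inj.
  rewrite big_map big_enum /= -(big_mkord xpredT (fun i => 'X - (z ^+ i)%:P)).
  rewrite (factor_Xn_sub_1 prim_z).
  rewrite mxminpoly_min // rmorphB /= rmorphXn rmorph1 /=.
  by rewrite horner_mx_X Am1 subrr.
case: dA => P uP /diagonalizable_forPex[D /(simmxP uP) PA].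
pose w i := row i P.
have wA i : w i *m A = D 0 i *: w i.
  by rewrite /w -row_mul PA row_mul row_diag_mx -scalemxAl -rowE.
have w0 i : w i != 0.
  rewrite /w rowE mulmx_free_eq0 ?row_free_unit //.
  by rewrite -mxrank_eq0 mxrank_delta.
have Dm i : D 0 i ^+ m == 1.
  have: w i *m A ^+ m = D 0 i ^+ m *: w i.
    elim: (m) => [|k IHk]; first by rewrite !expr0 mulmx1 scale1r.
    by rewrite exprSr -mulmxE mulmxA IHk -scalemxAl wA scalerA -exprSr.
  rewrite Am1 mulmx1 -{1}[w i]scale1r => /eqP.
  by rewrite -subr_eq0 -scalerBl scalemx_eq0 (negPf (w0 i)) orbF subr_eq0 eq_sym.
exists w, (fun i => val (sval (prim_rootP prim_z (eqP (Dm i))))); split=> [i|B wB].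
  by case: prim_rootP => j /= <-; rewrite wA.
rewrite -sub1mx -(mulVmx uP); apply: submx_trans (submxMl _ _) _.
exact/row_subP.
Qed.

(* If [rG] had a proper submodule [U], the ideals of the group algebra killing
   [U] and the quotient by [U] would not be contained in the kernel of the
   absolutely irreducible [r0], by dimension; so their product would map onto
   a nonzero ideal, hence onto the full matrix algebra, under [r0], while
   having zero trace in [rG]. *)
Lemma mx_irr_of_trace (F : fieldType) (gT : finGroupType) (G : {group gT}) n
    (rG r0 : mx_representation F G n) :
  mx_absolutely_irreducible r0 ->
  {in G, forall x, \tr (rG x) = \tr (r0 x)} ->
  mx_irreducible rG.
Proof.
move=> abs0 eqtr; have n_gt0 : (n > 0)%N by case/andP: abs0.
apply/mx_irrP; split=> // U modU nzU; apply: contraT => nfU.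
pose rU := submod_repr modU; pose rV := factmod_repr modU.
have rankU: (\rank U < n)%N by rewrite ltn_neqAle nfU rank_leq_row.
have rankV: (\rank (cokermx U) < n)%N.
  rewrite mxrank_coker -subn_gt0 subKn ?rank_leq_row //.
  by rewrite lt0n mxrank_eq0.
have tr_eq (a : 'rV_#|G|) : \tr (gring_mx rU a) + \tr (gring_mx rV a)
    = \tr (gring_mx r0 a).
  rewrite /gring_mx /= ![a *m _]mulmx_sum_row !linear_sum -big_split /=.
  apply: eq_bigr => i _; rewrite !linearZ /= !rowK !mxvecK -mulrDr.
  by rewrite mxtrace_sub_fact_mod eqtr ?enum_valP.
(* Dimension count: the image of the group algebra under [r] has dimension at most [k ^ 2 < n ^ 2],
   so the kernel of [r] is too large to lie in that of [r0]. *)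
have key k (r : mx_representation F G k) : (k < n)%N ->
    exists2 a : 'rV_#|G|, gring_mx r a = 0 & gring_mx r0 a != 0.
  move=> k_n; apply: NNPP => noa.
  have sub: (kermx (enveloping_algebra_mx r)
               <= kermx (enveloping_algebra_mx r0))%MS.
    apply/rV_subP => a /sub_kermxP ra0; apply/sub_kermxP.
    apply: NNPP => /eqP nz; apply: noa; exists a; rewrite /gring_mx /=.
      by rewrite ra0 linear0.
    by rewrite -(inj_eq (can_inj vec_mxK)) linear0 in nz.
  have rk0: \rank (enveloping_algebra_mx r0) = (n ^ 2)%N.
    by case/andP: abs0 => _ /eqP.
  have n_le := rank_leq_row (enveloping_algebra_mx r0).
  have r_le := rank_leq_row (enveloping_algebra_mx r).
  have rk_le : (\rank (enveloping_algebra_mx r) <= k ^ 2)%N := rank_leq_col _.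
  have := mxrankS sub; rewrite !mxrank_ker; rewrite rk0 in n_le *.
  rewrite leq_sub2lE // => /leq_trans/(_ rk_le).
  by rewrite leqNgt ltn_sqr k_n.
have [a aU a0] := key _ rU rankU.
have [b bV b0] := key _ rV rankV.
have mulE k (r : mx_representation F G k) c d :
    gring_mx r (c *m gring_mx (regular_repr F G) d) = gring_mx r c *m gring_mx r d.
  have := gring_opJ r (gring_mx (regular_repr F G) c) d.
  by rewrite gring_op_mx => <-; rewrite gring_opE gring_row_mul gring_mxK.
have surj (C : 'M[F]_n) : exists c : 'rV_#|G|, gring_mx r0 c = C.
  have /row_fullP[E' E'1] : row_full (enveloping_algebra_mx r0) by case/andP: abs0.
  by exists (mxvec C *m E'); rewrite /gring_mx /= -mulmxA E'1 mulmx1 mxvecK.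
(* With [c] and [d] mapping to [C] and [D], the product [a c b d] acts as 0 on [U] because of [a],
   and on the quotient because of [b]. *)
have tr0 C D : \tr (gring_mx r0 a *m C *m gring_mx r0 b *m D) = 0.
  have [[c <-] [d <-]] := (surj C, surj D).
  rewrite -!mulE -tr_eq !mulE bV mulmx0 mul0mx aU !mul0mx.
  by rewrite !mxtrace0 addr0.
move: (gring_mx r0 a) (gring_mx r0 b) tr0 a0 b0 => A B tr0.
move=> /matrix0Pn[i [j nzij]] /matrix0Pn[k [l nzkl]].
(* For these elementary matrices the trace is [A i j * B k l]. *)
have := tr0 (delta_mx j k) (delta_mx l i).
rewrite -(mul_delta_mx (0 : 'I_1) j k) -(mul_delta_mx (0 : 'I_1) l i).
rewrite !mulmxA mxtrace_mulC !mulmxA -rowE -!mulmxA.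
rewrite [delta_mx 0 k *m _]mulmxA -rowE -colE mulmxA -colE trace_mx11.
rewrite mxE big_ord1 !mxE => /eqP; rewrite mulf_eq0.
by rewrite (negPf nzij) (negPf nzkl).
Qed.

(** * Roots of unity in a modular system *)

Section Lifting.

Variables (p : nat) (S : modular_system p).
Local Notation K := (pmK S).
Local Notation O := (pmO S).
Local Notation F := (pmF S).
Local Notation emb := (@pm_emb p S).
Local Notation red := (@pm_red p S).

Definition p'root (z : O) := exists2 m, coprime p m & z ^+ m = 1.

Lemma pm_prime : prime p.
Proof. exact: pcharf_prime (pm_charF S). Qed.

(** If [z != w], the cofactor of [z - w] in [z ^+ M - w ^+ M = 0] vanishes; but it reduces to
    [red z ^+ M.-1 *+ M], which is nonzero because [p] does not divide [M]. *)
Lemma red_p'root_inj z w : p'root z -> p'root w -> red z = red w -> z = w.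
Proof.
move=> [m cpm zm] [k cpk wk] eqzw; pose M := (m * k)%N.
have zM : z ^+ M = 1 by rewrite exprM zm expr1n.
have wM : w ^+ M = 1 by rewrite /M mulnC exprM wk expr1n.
have : (z - w) * (\sum_(i < M) z ^+ (M.-1 - i) * w ^+ i) = 0.
  by rewrite -subrXX zM wM subrr.
move/eqP; rewrite mulf_eq0 subr_eq0 => /orP[/eqP // | /eqP sum0].
have M_gt0 : (0 < M)%N.
  have gt0 n : coprime p n -> (0 < n)%N.
    case: n => //; rewrite /coprime gcdn0 => /eqP p1.
    by have := prime_gt1 pm_prime; rewrite p1.
  by rewrite muln_gt0 !gt0.
have : red (\sum_(i < M) z ^+ (M.-1 - i) * w ^+ i) = red z ^+ M.-1 *+ M.
  rewrite rmorph_sum -[RHS]mulr_natr -[X in X%:R]card_ord mulr_natr -sumr_const.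
  apply: eq_bigr => i _; rewrite rmorphM !rmorphXn -eqzw -exprD subnK //.
  by rewrite -ltnS prednK.
rewrite sum0 rmorph0 => /esym/eqP; rewrite -mulr_natr mulf_eq0 expf_eq0.
case/orP=> [/andP[_ /eqP z0] | ].
  have := congr1 red zM; rewrite rmorphXn z0 rmorph1 expr0n gtn_eqF //.
  by move/esym/eqP; rewrite oner_eq0.
rewrite -(dvdn_pcharf (pm_charF S)) Euclid_dvdM ?pm_prime //.
by move: cpm cpk; rewrite !prime_coprime ?pm_prime // => /negPf-> /negPf->.
Qed.

(** Makes the value of a Brauer character independent of the chosen lifts: the residues determine
    the multiset of lifts, since reduction is injective on these roots. *)
Lemma p'root_sum_eq (s t : seq O) :
  {in s, forall z, p'root z} -> {in t, forall z, p'root z} ->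
  \prod_(z <- s) ('X - (red z)%:P) = \prod_(z <- t) ('X - (red z)%:P) ->
  \sum_(z <- s) emb z = \sum_(z <- t) emb z.
Proof.
move=> rs rt; rewrite -(big_map red xpredT (fun y => 'X - y%:P)).
rewrite -(big_map red xpredT (fun y => 'X - y%:P)) => /prod_XsubC_eq eqst.
pose r := s ++ t.
have rr : {in r, forall z, p'root z}.
  by move=> z; rewrite mem_cat => /orP[/rs|/rt].
pose g (y : F) := emb (nth 0 r (index y (map red r))).
have gE z : z \in r -> g (red z) = emb z.
  move=> rz; congr (emb _); have lt: (index (red z) (map red r) < size r)%N.
    by rewrite -(size_map red) index_mem map_f.
  apply: red_p'root_inj; [exact/rr/mem_nth | exact: rr |].
  by rewrite -(nth_map 0 0) // nth_index ?map_f.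
transitivity (\sum_(y <- map red s) g y).
  by rewrite big_map; apply: eq_big_seq => z sz; rewrite gE // mem_cat sz.
rewrite (perm_big _ eqst) big_map; apply: eq_big_seq => z tz.
by rewrite gE // mem_cat tz orbT.
Qed.

(** A root of unity has valuation 0, because the value group is torsion-free; so it lies in [O]. *)
Lemma lift_primitive_root m (w : K) : (0 < m)%N -> m.-primitive_root w ->
  exists2 z : O, m.-primitive_root z & emb z = w.
Proof.
move=> m_gt0 prim_w; have [v [[vM _ _] vO _]] := pm_cdvr S.
have w0 : w != 0 by rewrite (prim_root_eq0 prim_w) -lt0n.
have v1 : v 1 = 0.
  by apply: (@addrI _ (v 1)); rewrite -vM ?oner_eq0 // mulr1 addr0.
have vX k : v (w ^+ k) = v w *+ k.
  elim: k => [|k IHk]; first by rewrite expr0 v1.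
  by rewrite exprS vM ?expf_neq0 // IHk mulrS.
have vw : v w = 0.
  have := vX m; rewrite (prim_expr_order prim_w) v1 => /esym/eqP.
  by rewrite -mulr_natr mulf_eq0 pnatr_eq0 (gtn_eqF m_gt0) orbF => /eqP.
have [|z zw] := (vO w).2; first by right; rewrite vw.
exists z => //; rewrite /primitive_root_of_unity m_gt0 /=.
apply/forallP => i; move: prim_w => /andP[_ /forallP/(_ i)].
rewrite !unity_rootE -zw -rmorphXn -(rmorph1 emb).
by rewrite (inj_eq (@pm_emb_inj p S)).
Qed.

Lemma red_primitive_root m (z : O) :
  coprime p m -> m.-primitive_root z -> m.-primitive_root (red z).
Proof.
move=> cpm prim_z; have m_gt0 := prim_order_gt0 prim_z.
rewrite /primitive_root_of_unity m_gt0 /=; apply/forallP => i.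
move: (prim_z) => /andP[_ /forallP/(_ i)].
rewrite !unity_rootE -rmorphXn -(rmorph1 red) => /eqP <-.
apply/eqP; apply/eqP/eqP => [e|-> //]; apply: red_p'root_inj e.
  by exists m => //; rewrite exprAC (prim_expr_order prim_z) expr1n.
by exists 1%N; rewrite ?coprimen1.
Qed.

Lemma splits_primitive_root (gT : finGroupType) (G : {set gT}) x :
  splits_over_KF S G -> <[x]> \subset G -> p^'.-elt x ->
  exists2 z : O, #[x].-primitive_root z & #[x].-primitive_root (red z).
Proof.
move=> splitG sxG p'x; have [splitK _] := splitG _ sxG.
have p'nat : [pchar K]^'.-group <[x]>.
  apply: sub_pgroup (pgroup_pi _) => q _; rewrite inE /=.
  by have := @pm_charK p S q; rewrite [RHS]inE => ->.
have [w prim_w] : exists w : K, #[x].-primitive_root w.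
  (* Splitting of the cyclic group [<[x]>] yields the root only under [classically]; excluded middle
     extracts it. *)
  case: (classic (exists w : K, #[x].-primitive_root w)) => // now.
  have := splitting_cyclic_primitive_root_pchar (cycle_cyclic x) p'nat splitK.
  by move/(_ false) => /(_ (fun zP => False_ind _ (now (ex_intro _ _ (svalP zP))))).
have [z prim_z _] := lift_primitive_root (order_gt0 x) prim_w.
exists z => //; apply: red_primitive_root prim_z.
exact: pnat_coprime (pnat_id pm_prime) p'x.
Qed.

End Lifting.

(** * Induced matrices *)

(** An indexed family, so that it can label matrix blocks; two transversals with the same [k] can
    label rows and columns of one matrix. *)
Definition left_transversal (gT : finGroupType) (N K : {set gT}) k
    (t : 'I_k -> gT) : Prop :=
  [/\ forall i, t i \in N,
      forall i j, ((t i)^-1 * t j)%g \in K -> i = j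
    & forall n, n \in N -> exists i, ((t i)^-1 * n)%g \in K].

Lemma left_transversal_exists (gT : finGroupType) (N K : {group gT}) :
  K \subset N -> exists k (t : 'I_k -> gT), left_transversal N K t.
Proof.
move=> sKN; pose t (i : 'I_#|lcosets K N|) := repr (enum_val i).
have tP i : t i \in N /\ enum_val i = (t i *: K)%g.
  rewrite /t; have /lcosetsP[n Nn ->] := enum_valP i.
  have Kn : repr (n *: K)%g \in (n *: K)%g by rewrite (mem_repr n) ?lcoset_refl.
  by rewrite (lcoset_eqP Kn) (subsetP _ _ Kn) // mul_subG ?sub1set.
exists #|lcosets K N|, t; split=> [i | i j | n Nn]; first by case: (tP i).
  rewrite -mem_lcoset => /lcoset_eqP e; apply: enum_val_inj.
  by case: (tP i) (tP j) => _ -> [_ ->].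
have NKn : (n *: K)%g \in lcosets K N by apply/lcosetsP; exists n.
exists (enum_rank_in NKn (n *: K)%g); rewrite -mem_lcoset.
case: (tP (enum_rank_in NKn (n *: K)%g)) => _ <-.
by rewrite enum_rankK_in ?lcoset_refl.
Qed.

Section InducedMatrix.

Variables (F : fieldType) (gT : finGroupType).

(** [t] labels the rows and [u] the columns; for [x = 1] this is the change of basis between two
    transversals. Testing membership in [I] instead of [K] defines the map on all of [N I], with [t]
    still a transversal of [K] in [N]. *)
Definition indmx (I : {set gT}) n (P : gT -> 'M[F]_n) k (t u : 'I_k -> gT) x :
    'M[F]_(\sum_(i < k) n) :=
  \mxblock_(i, j) (if ((t i)^-1 * x * u j)%g \in I then P ((t i)^-1 * x * u j)%g
                   else 0).

Lemma scale_mxblock k n (c : F) (B : 'I_k -> 'I_k -> 'M[F]_n) :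
  c *: (\mxblock_(i, j) B i j : 'M_(\sum_(i < k) n)) = \mxblock_(i, j) (c *: B i j).
Proof. by apply/matrixP => i j; rewrite !mxE. Qed.

Section Transversal.

Variables (N I K J : {group gT}) (n k : nat) (P : gT -> 'M[F]_n).
Hypotheses (nNJ : J \subset 'N(N)) (defJ : J = (N * I)%g :> {set gT})
           (defK : N :&: I = K).
Implicit Types t u w : 'I_k -> gT.

Lemma indmx_coset_rep t i u j x : left_transversal N K t ->
  left_transversal N K u -> x \in J -> ((t i)^-1 * x * u j)%g \in (x *: N)%g.
Proof.
move=> [tN _ _] [uN _ _] Jx; rewrite mem_lcoset !mulgA groupMr //.
by rewrite -mulgA -/(conjg _ _) memJ_norm ?groupV // (subsetP nNJ).
Qed.

(** In each block column of the second factor at most one block is nonzero, so each block of the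
    product is a single product of values of [P]. Only arguments in the cosets of [x] and [y] occur,
    so [c] has to be valid only there. *)
Lemma indmx_mul c t u w x y :
  left_transversal N K t -> left_transversal N K u -> left_transversal N K w ->
  x \in J -> y \in J ->
  (forall a b, a \in I -> b \in I -> a \in (x *: N)%g -> b \in (y *: N)%g ->
     P a *m P b = c *: P (a * b)%g) ->
  indmx I P t u x *m indmx I P u w y = c *: indmx I P t w (x * y)%g.
Proof.
move=> Tt Tu Tw Jx Jy Pxy.
have sIJ : I \subset J by rewrite defJ mulG_subr.
rewrite mul_mxblock scale_mxblock; apply: eq_mxblock => i j.
(* Writing [y * w j = m * b] with [m] in [N] and [b] in [I], [l] is the index of the coset of
   [m]. *)
have [l Il] : exists l, ((u l)^-1 * y * w j)%g \in I.
  have: (y * w j)%g \in (N * I)%g.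
    by rewrite -defJ groupM // defJ (subsetP (mulG_subl _ _)) //; case: Tw.
  case/mulsgP=> m b Nm Ib e; have [_ _ /(_ m Nm)[l Kl]] := Tu; exists l.
  by rewrite -mulgA e mulgA groupMr //; move: Kl; rewrite -defK inE => /andP[].
rewrite (bigD1 l) //= big1 ?addr0 => [|l' /eqP ne_l].
  rewrite Il; case: ifP => [Ia|nIa].
    rewrite Pxy ?indmx_coset_rep // !mulgA mulgK.
    by move: (groupM Ia Il); rewrite !mulgA mulgK => ->.
  rewrite mul0mx -(groupMr _ Il) !mulgA mulgK in nIa *.
  by rewrite nIa scaler0.
case: ifP => _; last by rewrite mul0mx.
case: ifP => Il'; last by rewrite mulmx0.
case: ne_l; have [uN uinj _] := Tu; apply: uinj.
rewrite -defK inE groupM ?groupV //=.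
by have := groupM Il' (groupVr Il); rewrite !invMg invgK !mulgA !mulgK.
Qed.

Lemma indmx_central t x z : left_transversal N K t -> x \in I ->
  x \in 'C(N) -> P x = z%:M -> indmx I P t t x = z%:M.
Proof.
move=> [tN tinj _] Ix cNx Pxz; rewrite -mxdiagZ; apply: eq_mxblock => i j.
have -> : ((t i)^-1 * x * t j)%g = (x * ((t i)^-1 * t j))%g.
  by rewrite mulgA; congr (_ * _)%g; rewrite (centP cNx) ?groupV.
rewrite groupMl //; case: eqVneq => [<-|ne_ij].
  by rewrite mulVg group1 mulg1 conform_mx_id.
case: ifP => // Iij; case/eqP: ne_ij; apply: tinj.
by rewrite -defK inE Iij groupM ?groupV.
Qed.

Lemma indmx1 t : left_transversal N K t -> P 1%g = 1%:M -> indmx I P t t 1 = 1%:M.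
Proof.
by move=> Tt P1; apply: indmx_central => //; apply: group1.
Qed.

Lemma indmx_conj (f : {rmorphism F -> F}) t a x :
  a \in 'N(I) -> map_mx f (indmx I P t t (x ^ a^-1)%g) =
  indmx I (fun y => map_mx f (P (y ^ a^-1)%g)) (fun i => (t i ^ a)%g)
    (fun i => (t i ^ a)%g) x.
Proof.
move=> nIa; apply/mxblockP => i j; rewrite mxblockK.
have -> : submxblock (map_mx f (indmx I P t t (x ^ a^-1)%g)) i j
    = map_mx f (submxblock (indmx I P t t (x ^ a^-1)%g) i j).
  by apply/matrixP => r s; rewrite !mxE.
rewrite mxblockK.
have -> : ((t i)^-1 * x ^ a^-1 * t j
           = ((t i ^ a)^-1 * x * (t j ^ a)) ^ a^-1)%g.
  by rewrite -{1}[t i](conjgK a) -{1}[t j](conjgK a) -conjVg -!conjMg.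
rewrite memJ_norm ?groupV //; case: ifP => //; by rewrite map_mx0.
Qed.

Lemma indmx_similar (W : 'M[F]_n) (Q : gT -> 'M[F]_n) c t x :
  left_transversal N K t -> x \in J ->
  (forall g, g \in I -> g \in (x *: N)%g -> W *m Q g = c *: (P g *m W)) ->
  (\mxdiag_(i < k) W) *m indmx I Q t t x
    = c *: (indmx I P t t x *m \mxdiag_(i < k) W).
Proof.
move=> Tt Jx WQ; rewrite mul_mxdiag_mxblock mul_mxblock_mxdiag scale_mxblock.
apply: eq_mxblock => i j; case: ifP => [Ig|_]; last first.
  by rewrite mulmx0 mul0mx scaler0.
by rewrite WQ ?indmx_coset_rep.
Qed.

Lemma unitmx_mxdiag (W : 'M[F]_n) : W \in unitmx -> \mxdiag_(i < k) W \in unitmx.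
Proof.
move=> uW; have: \mxdiag_(i < k) W *m \mxdiag_(i < k) invmx W = 1%:M.
  rewrite {2}/mxdiag mul_mxdiag_mxblock -mxdiagZ; apply: eq_mxblock => i j.
  by case: eqP => _; rewrite ?mulmx0 // !conform_mx_id mulmxV.
by case/mulmx1_unit.
Qed.

End Transversal.

End InducedMatrix.

(** * Eigenvalues of an induced representation *)

Section CyclicVectors.

Variables (F : fieldType) (d r : nat) (A : 'M[F]_d) (U : nat -> 'rV[F]_d).
Hypothesis UA : forall l, U l *m A = U l.+1.

(** A component of a discrete Fourier transform: when [U r = w ^+ r *: U 0], the shift [A] acts on
    it as the scalar [w]. *)
Definition cyclic_vector (w : F) := \sum_(l < r) w ^- l *: U l.

Lemma cyclic_vector_eigen w : w != 0 -> U r = w ^+ r *: U 0%N ->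
  cyclic_vector w *m A = w *: cyclic_vector w.
Proof.
move=> w0 Ur; rewrite /cyclic_vector mulmx_suml scaler_sumr.
pose g l := w ^- l *: U l.
have gS l : g l *m A = w *: g l.+1.
  rewrite /g -scalemxAl UA scalerA exprS invfM mulrA divff ?mul1r //.
under eq_bigr => l _ do rewrite gS.
(* The two sums of [g] run over 1 to [r] and over 0 to [r - 1]; they agree because [g r = g 0]. *)
rewrite -!scaler_sumr; congr (_ *: _); apply: (@addrI _ (g 0%N)).
rewrite -(big_ord_recl r (fun l : 'I_r.+1 => g l)) big_ord_recr addrC /=.
by congr (_ + _); rewrite /g Ur scalerA mulVf ?expf_neq0 // expr0 invr1.
Qed.

(** Fourier inversion: the coefficient of [U l] contains the geometric sum of ratio
    [y ^+ i / y ^+ l], which vanishes unless [l = i]. *)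
Lemma cyclic_vector_span w y i : (i < r)%N -> r.-primitive_root y -> w != 0 ->
  \sum_(a < r) (w * y ^+ a) ^+ i *: cyclic_vector (w * y ^+ a) = r%:R *: U i.
Proof.
move=> lt_ir prim_y w0.
  have y0 : y != 0.
    by rewrite (prim_root_eq0 prim_y) -lt0n (prim_order_gt0 prim_y).
have wy0 a : w * y ^+ a != 0 by rewrite mulf_neq0 ?expf_neq0.
transitivity (\sum_(l < r) (\sum_(a < r) (y ^+ i / y ^+ l) ^+ a)
                             *: (w ^+ i / w ^+ l *: U l)).
  under eq_bigr => a _ do rewrite scaler_sumr.
  rewrite exchange_big /=; apply: eq_bigr => l _; rewrite scaler_suml.
  apply: eq_bigr => a _; rewrite !scalerA; congr (_ *: _).
  rewrite !exprMn invfM !exprVn [(y ^+ a) ^+ i]exprAC [(y ^+ a) ^+ l]exprAC.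
  by rewrite mulrACA mulrC.
rewrite (bigD1 (Ordinal lt_ir)) //= [X in _ + X]big1 ?addr0 => [|l ne_li].
  have -> : y ^+ i / y ^+ i = 1 by rewrite divff ?expf_neq0.
  under eq_bigr => a _ do rewrite expr1n.
  by rewrite sumr_const card_ord divff ?expf_neq0 // scale1r.
set q := y ^+ i / y ^+ l.
have q1 : q != 1.
  apply: contraNneq ne_li => /divr1_eq/eqP.
  by rewrite (eq_prim_root_expr prim_y) !modn_small // => /eqP e; apply/eqP/val_inj.
have : (q - 1) * (\sum_(a < r) q ^+ a) = 0.
  rewrite -subrX1 /q expr_div_n ![(y ^+ _) ^+ r]exprAC (prim_expr_order prim_y).
  by rewrite !expr1n divr1 subrr.
by move/eqP; rewrite mulf_eq0 subr_eq0 (negPf q1) /= => /eqP->; rewrite scale0r.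
Qed.

End CyclicVectors.

Lemma transversal_sum (V : nmodType) (gT : finGroupType) (N K : {group gT}) k
    (t : 'I_k -> gT) (f : gT -> V) :
  K \subset N -> left_transversal N K t ->
  (forall g h, g \in N -> h \in K -> f (g * h)%g = f g) ->
  \sum_(g in N) f g = (\sum_i f (t i)) *+ #|K|.
Proof.
move=> sKN [tN tinj tsurj] fK.
transitivity (\sum_(g in N) \sum_(i | ((t i)^-1 * g)%g \in K) f (t i)).
  apply: eq_bigr => g Ng; have [i Ki] := tsurj g Ng.
  rewrite (big_pred1 i) => [|j]; first by rewrite -(fK _ _ (tN i) Ki) mulKVg.
  apply/idP/eqP => [Kj|-> //]; apply: tinj.
  by have := groupM Kj (groupVr Ki); rewrite invMg invgK mulgA mulgK.
rewrite (exchange_big_dep predT) //= -sumrMnl; apply: eq_bigr => i _.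
rewrite sumr_const -(card_lcoset K (t i)); congr (_ *+ _).
apply: eq_card => g; rewrite mem_lcoset [LHS]unfold_in /= andb_idl // => Kg.
by rewrite -[g](mulKVg (t i)) groupM // (subsetP sKN).
Qed.

Section InducedElement.

Variables (F : fieldType) (gT : finGroupType) (N K : {group gT}).
Variables (n k : nat) (P : gT -> 'M[F]_n) (t : 'I_k -> gT).
Hypotheses (sKN : K \subset N) (reprP : mx_repr K P)
           (Tt : left_transversal N K t).
Local Notation R := (indmx K P t t).

Lemma indmx_repr : mx_repr N R.
Proof.
have [P1 PM] := reprP.
have defK : N :&: K = K by apply/setIidPr.
split=> [|x y Nx Ny]; first exact: (@indmx1 _ _ N K K _ _ _ defK).
rewrite (@indmx_mul _ _ N K K N _ _ _ (normG N) _ defK 1) ?scale1r //.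
  by rewrite mulGSid.
by move=> a b Ka Kb _ _; rewrite PM // scale1r.
Qed.

Definition block_incl (i : 'I_k) : 'M[F]_(n, \sum_(j < k) n) :=
  \mxrow_j (if j == i then 1%:M else 0).

Lemma block_incl_mul i j x : ((t i)^-1 * x * t j)%g \in K ->
  block_incl i *m R x = P ((t i)^-1 * x * t j)%g *m block_incl j.
Proof.
move=> Kij; rewrite mul_mxrow_mxblock mul_mxrow; apply: eq_mxrow => l.
rewrite (bigD1 i) //= big1 ?addr0 => [|i' /negPf->]; last by rewrite mul0mx.
rewrite eqxx mul1mx; case: eqP => [->|ne_lj]; first by rewrite Kij mulmx1.
rewrite mulmx0; case: ifP => // Kil; case: ne_lj.
have [_ tinj _] := Tt; apply/esym/tinj.
by have := groupM (groupVr Kij) Kil; rewrite !invMg invgK !mulgA mulgK mulgKV.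
Qed.

Lemma block_incl_full (B : 'M[F]_(\sum_(j < k) n)) :
  (forall i, block_incl i <= B)%MS -> row_full B.
Proof.
move=> sB; rewrite -sub1mx; apply/rV_subP => u _.
have -> : u = \sum_i submxrow u i *m block_incl i.
  rewrite -[LHS]submxrowK; under [RHS]eq_bigr => i _ do rewrite mul_mxrow.
  rewrite -mxrow_sum; apply: eq_mxrow => j.
  rewrite (bigD1 j) //= eqxx mulmx1 big1 ?addr0 // => i /negPf.
  by rewrite eq_sym => ->; rewrite mulmx0.
by apply: summx_sub => i _; apply: submx_trans (sB i); apply: submxMl.
Qed.

Variables (x : gT) (y : F).
Hypotheses (Nx : x \in N) (prim_y : #[x].-primitive_root y).

Lemma coset_perm : exists2 pi : 'I_k -> 'I_k, injective pi &
  forall i, ((t i)^-1 * x * t (pi i))%g \in K.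
Proof.
have [tN tinj tsurj] := Tt.
have /fin_all_exists[pi piP] i : exists j, ((t i)^-1 * x * t j)%g \in K.
  have [|j Kj] := tsurj (x^-1 * t i)%g; first by rewrite groupM ?groupV.
  by exists j; rewrite -groupV !invMg invgK.
exists pi => // i i' e; apply: tinj; have := piP i'; rewrite -e => Ki'.
have := groupM (piP i) (groupVr Ki').
by rewrite !invMg !invgK !mulgA mulgK mulgK.
Qed.

(** On an orbit of [pi] of length [r], the power [x ^+ r] acts on a block through an element of [K],
    and the eigenvalues of [x] on the orbit are all the [r]-th roots of the eigenvalues of that
    element. Passing from block [i] to block [pi i] multiplies them by [y ^+ c i] with [c i = #[x] /
    r]; this shift is what makes the lifts cancel on moved blocks. *)
Lemma indmx_eigenvalues :
  exists (pi : 'I_k -> 'I_k) (c : 'I_k -> nat) (e : 'I_k -> 'I_n -> nat),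
    [/\ injective pi /\ (forall i, (pi i == i) = (x ^ t i \in K)%g),
        char_poly (R x) =
          \prod_(ij : 'I_k * 'I_n) ('X - (y ^+ e ij.1 ij.2)%:P),
        forall i, c (pi i) = c i /\
          forall j, (e (pi i) j = c i + e i j %[mod #[x]])%N,
        forall i, pi i != i -> ~~ (#[x] %| c i)%N
      & forall i, pi i == i ->
          char_poly (P (x ^ t i)%g) = \prod_j ('X - (y ^+ e i j)%:P)].
Proof.
have [tN tinj tsurj] := Tt; have [P1 PM] := reprP; have [R1 RM] := indmx_repr.
have [pi pi_inj piP] := coset_perm; set m := #[x].
have m_gt0 : (0 < m)%N := order_gt0 x.
have iterP l i : ((t i)^-1 * x ^+ l * t (iter l pi i))%g \in K.
  elim: l => [|l IHl]; first by rewrite mulg1 mulVg.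
  rewrite iterS; have := groupM IHl (piP (iter l pi i)).
  by rewrite !mulgA mulgK -[(_ * x ^+ l * x)%g]mulgA -expgSr.
have iter_uniq l i j : ((t i)^-1 * x ^+ l * t j)%g \in K -> iter l pi i = j.
  move=> Kj; apply: tinj; have := groupM (groupVr (iterP l i)) Kj.
  by rewrite !invMg invgK !mulgA mulgK mulgKV.
have iterm i : iter m pi i = i.
  by apply: iter_uniq; rewrite expg_order mulg1 mulVg.
pose r s := fingraph.order pi s.
have r_gt0 s : (0 < r s)%N by exact: fingraph.order_gt0.
have dvd_rm s : (r s %| m)%N.
  have iterM q : iter (q * r s) pi s = s.
    by elim: q => // q IHq; rewrite mulSn iterD IHq iter_order.
  have := iterm s; rewrite {1}(divn_eq m (r s)) addnC iterD iterM => e.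
  have := findex_iter (ltn_pmod m (r_gt0 s)); rewrite e findex0 => /esym/eqP.
  by [].
have prim_r s : (m %/ r s).-primitive_root (y ^+ r s).
  have -> : y ^+ r s = y ^+ (m %/ (m %/ r s)).
    by congr (_ ^+ _); rewrite -{1}(divnK (dvd_rm s)) mulKn // divn_gt0 // dvdn_leq.
  have := dvdn_prim_root prim_y (dvdn_div (dvd_rm s)). by [].
(* The first return to block [s]. The order of [P (b s)] divides [m %/ r s], so its eigenvalues are
   powers of [y ^+ r s]. *)
pose b s := ((t s)^-1 * x ^+ r s * t s)%g.
have Kb s : b s \in K by have := iterP (r s) s; rewrite iter_order.
have bX s q : (b s ^+ q = (t s)^-1 * x ^+ (r s * q) * t s)%g.
  by rewrite /b -mulgA -/(conjg _ _) -conjXg -expgM conjgE mulgA.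
have Pb s : iter (m %/ r s) (mulmx (P (b s))) 1%:M = 1%:M.
  have -> q : iter q (mulmx (P (b s))) 1%:M = P (b s ^+ q)%g.
    elim: q => [|q IHq]; first by rewrite expg0 P1.
    by rewrite iterS IHq -PM ?groupX ?Kb // -expgS.
  by rewrite bX mulnC divnK // expg_order mulg1 mulVg.
have [w wP] := fin_all_exists (fun s => finite_order_eigenbasis (prim_r s) (Pb s)).
have [e0 {}wP] := fin_all_exists wP.
pose root i := froot pi i; pose c i := (m %/ r (root i))%N.
pose f i := findex pi (root i) i.
have con i : fconnect pi (root i) i.
  by rewrite fconnect_sym // connect_root.
have root_pi i : root (pi i) = root i.
  by apply/esym/(fingraph.rootP (fconnect_sym pi_inj)); exact: fconnect1.
have iter_f i : iter (f i) pi (root i) = i by exact: iter_findex.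
have lt_f i : (f i < r (root i))%N by exact: findex_max.
have cr i : (c i * r (root i) = m)%N by rewrite divnK.
(* [y ^+ e i j] is an [r (root i)]-th root of the eigenvalue of index [j] of the first return at
   [root i]; the position [f i] in the orbit selects which one. *)
pose e i j := (f i * c i + e0 (root i) j)%N.
have fixE i : (pi i == i) = (x ^ t i \in K)%g.
  rewrite conjgE mulgA; apply/eqP/idP => [ii | Ki]; first by rewrite -{2}ii piP.
  by rewrite -[RHS](iter_uniq 1%N i i) ?expg1.
have fix_r i : pi i = i -> root i = i /\ r (root i) = 1%N.
  move=> ii; have iter_i q : iter q pi i = i by elim: q => //= q ->.
  have ri : root i = i.
    by rewrite -[LHS](iter_findex (connect_root (frel pi) i)) iter_i.
  split=> //; rewrite ri; apply/eqP; rewrite eqn_leq r_gt0 andbT leqNgt.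
  by apply/negP=> /findex_iter; rewrite iter_i findex0.
(* On the span of an orbit, the eigenvectors of x are the discrete Fourier
   transforms of the sequences U s j; the block i of the orbit indexes the
   frequencies. *)
pose U s j l := w s j *m block_incl s *m R (x ^+ l)%g.
pose v (ij : 'I_k * 'I_n) :=
  let s := root ij.1 in cyclic_vector (r s) (U s ij.2) (y ^+ e ij.1 ij.2).
have y0 : y != 0 by rewrite (prim_root_eq0 prim_y) -lt0n.
have UR s j l : U s j l *m R x = U s j l.+1.
  by rewrite /U -mulmxA -RM ?groupX // -expgSr.
have bsR s : block_incl s *m R (x ^+ r s)%g = P (b s) *m block_incl s.
  exact: (block_incl_mul (Kb s)).
exists pi, c, e; split.
- by split.
- apply: (@char_poly_eigenbasis _ _ _ _ v) => [|[i j]|B vB].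
  + by rewrite card_prod !card_ord sum_nat_const card_ord.
  + apply: (cyclic_vector_eigen (UR _ _)); first by rewrite expf_neq0.
    rewrite /U -mulmxA bsR mulmxA (wP _).1 -!scalemxAl expg0 R1 mulmx1.
    congr (_ *: _); rewrite -!exprM mulnC /e mulnDl -mulnA cr exprD.
    rewrite [(f _ * m)%N]mulnC [y ^+ (m * _)]exprM.
    by rewrite (prim_expr_order prim_y) expr1n mul1r.
  (* As [i] runs through the orbit of [s], the frequencies run through all [r s]-th roots of one
     eigenvalue, and Fourier inversion recovers [U s j l]; [r s] is invertible in [F] because it
     divides the order of [y]. *)
  have UB s j l : root s = s -> (l < r s)%N -> (U s j l <= B)%MS.
    move=> rs lt_lr; have c_r : (r s).-primitive_root (y ^+ c s).
      by have := dvdn_prim_root prim_y (dvd_rm s); rewrite /c rs.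
    have ye0 : y ^+ e0 s j != 0 by rewrite expf_neq0.
    have := cyclic_vector_span (U s j) lt_lr c_r ye0.
    have r_neq0 : (r s)%:R != 0 :> F := prim_root_dvd_eq0 prim_y (dvd_rm s).
    move=> eqU; rewrite -[U s j l](scalerK r_neq0) -eqU.
    apply/scalemx_sub/summx_sub => a _.
    apply: scalemx_sub; pose i := iter a pi s.
    have ri : root i = s.
      rewrite -rs; apply/esym/(fingraph.rootP (fconnect_sym pi_inj)).
      exact: fconnect_iter.
    have := vB (i, j); rewrite /v /= ri /e ri /f ri findex_iter //.
    by rewrite exprD mulrC mulnC exprM /c ri rs.
  apply: block_incl_full => i; pose s := root i.
  have rs : root s = s by apply: root_root; exact: fconnect_sym.
  (* The eigenvectors [w s j] span the block, so it suffices that [B] contains the vectors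
     [U s j (f i)]. Cancelling the invertible [P g] afterwards leads from block [s] to block [i]. *)
  have sB : (block_incl s *m R (x ^+ f i)%g <= B)%MS.
    set Y := _ *m _; rewrite submxE -[_ *m _]mul1mx; apply/eqP/sub_kermxP.
    rewrite sub1mx; apply: (wP s).2 => j; apply/sub_kermxP; rewrite mulmxA.
    by apply/eqP; rewrite -submxE mulmxA; apply: UB (lt_f i).
  have := iterP (f i) s; rewrite iter_f => Kg.
  have := Kg; rewrite -groupV => Kg'; move: sB; rewrite (block_incl_mul Kg).
  move: (_ * t i)%g Kg Kg' => g Kg Kg' sB.
  rewrite -[block_incl i]mul1mx -P1 -(mulVg g) PM // -mulmxA.
  by apply: submx_trans sB; apply: submxMl.
- move=> i; split; first by rewrite /c root_pi.
  move=> j; rewrite /e /c root_pi -/(c i) addnA -mulSn.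
  have pi_f : pi i = iter (f i).+1 pi (root i) by rewrite iterS iter_f.
  (* If [i] is last in its orbit, [f] drops from [r - 1] to 0, and the congruence holds because
     [r * c i = m]. *)
  have := lt_f i; rewrite leq_eqVlt => /orP[/eqP fr | lt_f1].
    rewrite fr [(r _ * _)%N]mulnC cr modnDl /f root_pi pi_f fr.
    by rewrite iter_order // findex0.
  by rewrite {1}/f root_pi pi_f findex_iter.
- move=> i; apply: contra => dvd_mc.
  have c_gt0 : (0 < c i)%N by rewrite divn_gt0 // dvdn_leq.
  have := dvdn_leq c_gt0 dvd_mc.
  rewrite -{1}(cr i) -{2}[c i]muln1 leq_pmul2l // => r1.
  have {}r1 : r (root i) = 1%N by apply/eqP; rewrite eqn_leq r1 r_gt0.
  have := lt_f i; rewrite r1 ltnS leqn0 => /eqP f0.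
  have ri : root i = i by rewrite -[RHS]iter_f f0.
  by have := iter_order pi_inj (root i); rewrite -/(r _) r1 ri /= => ->.
- move=> i /eqP /fix_r[ri r1]; have [wE wfull] := wP i; rewrite ri in r1.
  have -> : (x ^ t i)%g = b i by rewrite /b r1 expg1 conjgE mulgA.
  apply: char_poly_eigenbasis wfull; first by rewrite card_ord.
  move=> j; rewrite wE r1 expr1 /e ri.
  by have := lt_f i; rewrite ri r1 ltnS leqn0 => /eqP->.
Qed.
End InducedElement.

(** * Induction of Brauer characters *)

(** Telescoping: [a i = g i - g (pi i)] for [g i = a i / (1 - rho i)], and [pi] permutes the indices
    that it moves. *)
Lemma twisted_sum0 (L : fieldType) k (pi : 'I_k -> 'I_k) (a rho : 'I_k -> L) :
  injective pi -> (forall i, a (pi i) = rho i * a i) ->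
  (forall i, rho (pi i) = rho i) -> (forall i, pi i != i -> rho i != 1) ->
  \sum_(i | pi i != i) a i = 0.
Proof.
move=> pi_inj aP rhoP rho1; pose g i := a i / (1 - rho i).
transitivity (\sum_(i | pi i != i) (g i - g (pi i))).
  apply: eq_bigr => i /rho1 nz; rewrite /g rhoP aP -mulrBl -{2}[a i]mul1r -mulrBl.
  by rewrite mulrC mulrA mulVf ?mul1r // subr_eq0 eq_sym.
rewrite sumrB [X in X - _](reindex_inj pi_inj) /=.
by apply/eqP; rewrite subr_eq0; apply/eqP/eq_bigl => i; rewrite (inj_eq pi_inj).
Qed.

Section BrauerInduction.

Variables (p : nat) (S : modular_system p) (gT : finGroupType).
Variables (N K : {group gT}) (n k : nat).
Variables (P : gT -> 'M[pmF S]_n) (t : 'I_k -> gT) (chi : brauer_fun S gT).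
Hypotheses (sKN : K \subset N) (reprP : mx_repr K P)
           (affP : affords_brauer K P chi).
Local Notation emb := (@pm_emb p S).
Local Notation red := (@pm_red p S).

Lemma affords_brauer_classfun y h : h \in K -> chi (y ^ h)%g = chi y.
Proof.
move=> Kh; have [affP1 affP2] := affP; have [P1 PM] := reprP.
have reg_yh : ((y ^ h)%g \in K) && p^'.-elt (y ^ h)%g = (y \in K) && p^'.-elt y.
  by rewrite groupJr // /p_elt orderJ.
have [/andP[Ky p'y] | nreg] := boolP ((y \in K) && p^'.-elt y); last first.
  by rewrite !affP2 // reg_yh.
have /andP[Kyh p'yh] : ((y ^ h)%g \in K) && p^'.-elt (y ^ h)%g.
  by rewrite reg_yh Ky.
have [s [s_root chs ->]] := affP1 _ Kyh p'yh.
have [s' [s'_root chs' ->]] := affP1 _ Ky p'y.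
apply: p'root_sum_eq => //; rewrite -chs -chs'.
apply: (@char_poly_similar _ _ (P h)); last by rewrite -!PM // -conjgC.
have: P h *m P h^-1%g = 1%:M by rewrite -PM ?groupV // mulgV P1.
by case/mulmx1_unit.
Qed.

Lemma brauer_IndE y : left_transversal N K t ->
  brauer_Ind N K chi y = \sum_i chi (y ^ t i)%g.
Proof.
move=> Tt; rewrite ffunE (transversal_sum sKN Tt (f := fun g => chi (y ^ g)%g)).
  rewrite mulrnAr -mulrnAl -[X in X * _]mulr_natr mulVf ?mul1r //.
  have /pcharf0P-> : [pchar pmK S] =i pred0 := pm_charK S.
  by rewrite -lt0n cardG_gt0.
by move=> g h Ng Kh; rewrite conjgM affords_brauer_classfun.
Qed.

Lemma affords_indmx : left_transversal N K t ->
  (forall x, x \in N -> p^'.-elt x ->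
     exists2 z : pmO S, #[x].-primitive_root z & #[x].-primitive_root (red z)) ->
  affords_brauer N (indmx K P t t) (brauer_Ind N K chi).
Proof.
move=> Tt lift_root; have [affP1 affP2] := affP; have [tN _ _] := Tt.
split=> x; last first.
  move=> nreg; rewrite brauer_IndE // big1 // => i _; rewrite affP2 //.
  apply: contra nreg => /andP[Kx]; rewrite /p_elt orderJ => ->.
  by rewrite andbT -(groupJr x (tN i)) (subsetP sKN).
move=> Nx p'x; have [z prim_z prim_rz] := lift_root x Nx p'x.
have [pi [c [e [[pi_inj pi_fix] chR eP c_nfix chP]]]] :=
  indmx_eigenvalues sKN reprP Tt Nx prim_rz.
have cpx : coprime p #[x] := pnat_coprime (pnat_id (pm_prime S)) p'x.
have rootX l : p'root (z ^+ l).
  by exists #[x] => //; rewrite exprAC (prim_expr_order prim_z) expr1n.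
exists [seq z ^+ e ij.1 ij.2 | ij : 'I_k * 'I_n]; split.
- by move=> _ /imageP[ij _ ->]; apply: rootX.
- by rewrite chR big_image /=; apply: eq_bigr => ij _; rewrite rmorphXn.
rewrite brauer_IndE // big_image /=.
rewrite -(pair_bigA _ (fun i j => emb (z ^+ e i j))) /=.
pose a i := \sum_j emb (z ^+ e i j).
rewrite [RHS](bigID (fun i => pi i == i)) [LHS](bigID (fun i => pi i == i)) /=.
congr (_ + _).
  apply: eq_bigr => i fix_i; have Kx : (x ^ t i)%g \in K by rewrite -pi_fix.
  have [|s [s_root chs ->]] := affP1 _ Kx; first by rewrite /p_elt orderJ.
  rewrite -(big_map (fun j => z ^+ e i j) xpredT emb).
  apply: p'root_sum_eq => //; first by move=> _ /mapP[j _ ->]; apply: rootX.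
  rewrite -chs chP // big_map.
  by apply: eq_bigr => j _; rewrite rmorphXn.
rewrite big1 => [|i]; last first.
  by rewrite pi_fix => nK; rewrite affP2 // (negPf nK).
(* On moved blocks, [pi] multiplies the sum of the lifts by [z ^+ c i], a root of unity different
   from 1. *)
rewrite (twisted_sum0 (rho := fun i => emb (z ^+ c i)) pi_inj) //.
- move=> i; rewrite mulr_sumr; apply: eq_bigr => j _; rewrite -rmorphM -exprD.
  congr (emb _); apply/eqP; rewrite (eq_prim_root_expr prim_z).
  by have [_ ->] := eP i.
- by move=> i; have [-> _] := eP i.
move=> i /c_nfix; apply: contra => /eqP; rewrite -(rmorph1 emb) => /pm_emb_inj/eqP.
by rewrite -(prim_order_dvd prim_z).
Qed.

End BrauerInduction.

(** * Representations affording an irreducible Brauer character *)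

Section IrreducibleBrauer.

Variables (p : nat) (S : modular_system p) (gT : finGroupType).
Local Notation emb := (@pm_emb p S).
Local Notation red := (@pm_red p S).

(** [a] is the sum of the lifts in [O]. As [emb] is injective, the Brauer character determines the
    traces at [p]-regular elements. *)
Lemma affords_brauer_trace (X : {set gT}) n (R : gT -> 'M[pmF S]_n)
    (chi : brauer_fun S gT) x :
  affords_brauer X R chi -> x \in X -> p^'.-elt x ->
  exists2 a, chi x = emb a & \tr (R x) = red a.
Proof.
move=> [affR _] Xx p'x; have [s [_ chs ->]] := affR x Xx p'x.
exists (\sum_(z <- s) z); rewrite rmorph_sum //=.
have sz_s : size s = n.
  apply: succn_inj; rewrite -(size_char_poly (R x)) chs.
  by rewrite -(big_map red xpredT (fun y => 'X - y%:P)) size_prod_XsubC size_map.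
have [n0|n_gt0] := posnP n.
  have /size0nil-> : size s = 0%N by rewrite sz_s.
  rewrite big_nil.
  by rewrite /mxtrace big1 // => i; have := ltn_ord i; rewrite {2}n0.
apply: oppr_inj; rewrite -char_poly_trace // chs.
rewrite -(big_map red xpredT (fun y => 'X - y%:P)) -(big_map red xpredT id).
have := @coefPn_prod_XsubC _ (map red s); rewrite size_map sz_s -lt0n.
exact.
Qed.

(** A lift of 1 of order prime to [p] equals 1, so the value at the identity counts eigenvalues. *)
Lemma affords_brauer_degree (X : {group gT}) n (R : gT -> 'M[pmF S]_n)
    (chi : brauer_fun S gT) :
  affords_brauer X R chi -> R 1%g = 1%:M -> chi 1%g = n%:R.
Proof.
move=> [affR _] R1; have [|s [s_root chs ->]] := affR 1%g (group1 X).
  by rewrite /p_elt order1.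
have {}chs : char_poly (R 1%g) = \prod_(y <- map red s) ('X - y%:P).
  by rewrite chs big_map.
have: perm_eq (map red s) (nseq n 1).
  apply: prod_XsubC_eq; rewrite -chs R1 char_poly_trig ?scalar_mx_is_trig //.
  rewrite big_nseq -big_const_ord.
  by apply: eq_bigr => i _; rewrite mxE eqxx mulr1n.
move=> eq_s; have s1 : {in s, forall z, z = 1}.
  move=> z sz; apply: (@red_p'root_inj p S); first exact: s_root.
    by exists 1%N; rewrite ?coprimen1.
  have := map_f red sz; rewrite (perm_mem eq_s) mem_nseq => /andP[_ /eqP->].
  by rewrite rmorph1.
rewrite (eq_big_seq (fun=> 1)) => [|z /s1->]; last exact: rmorph1.
rewrite big_const_seq count_predT iter_addr_0.
by rewrite -(size_map red) (perm_size eq_s) size_nseq.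
Qed.

(** [R] has the degree and the traces of an irreducible representation affording [chi]: degrees are
    compared in characteristic 0, and traces at [p']-parts. *)
Lemma affords_IBr_abs_irr (X : {group gT}) n (R : mx_representation (pmF S) X n)
    (chi : brauer_fun S gT) :
  IBr X chi -> affords_brauer X R chi -> group_splitting_field (pmF S) X ->
  mx_absolutely_irreducible R.
Proof.
move=> [m [R0 [irrR0 affR0]]] affR splitX.
have eq_mn : m = n.
  have := affords_brauer_degree affR (repr_mx1 R).
  rewrite (affords_brauer_degree affR0 (repr_mx1 R0)).
  have natr_inj a b : (a <= b)%N -> a%:R = b%:R :> pmK S -> a = b.
    move=> le_ab eq_ab; apply/eqP; rewrite eqn_leq le_ab -subn_eq0 /=.
    have /pcharf0P<- : [pchar pmK S] =i pred0 := pm_charK S.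
    by rewrite natrB // eq_ab subrr.
  by case/orP: (leq_total m n) => /natr_inj inj /esym => [/esym|] /inj.
subst m; have abs0 := splitX _ _ irrR0.
apply: splitX; apply: (mx_irr_of_trace abs0) => x Xx.
rewrite (mxtrace_repr_p'part R (pm_charF S)) //.
rewrite (mxtrace_repr_p'part R0 (pm_charF S)) //.
have Xx' : (x.`_p^')%g \in X by rewrite groupX.
have [a chia ->] := affords_brauer_trace affR Xx' (p_elt_constt _ _).
have [a0 chia0 ->] := affords_brauer_trace affR0 Xx' (p_elt_constt _ _).
by congr (red _); apply: (@pm_emb_inj p S); rewrite -chia.
Qed.

End IrreducibleBrauer.

(** * Stabilizers *)

Section Stabilizers.

Variables (p : nat) (S : modular_system p) (hT : finGroupType).
Variables (HH : automorphism_group S hT) (gT : finGroupType).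
Local Notation bfun := (brauer_fun S gT).
Implicit Types (chi : bfun) (B X : {set gT}).

Lemma bact1E chi g x : bact HH chi (1, g)%g x = chi (x ^ g^-1)%g.
Proof. by rewrite ffunE autK1. Qed.

Lemma bact1 chi : bact HH chi 1%g = chi.
Proof. by apply/ffunP => x; rewrite bact1E invg1 conjg1. Qed.

Lemma stabP B X chi g :
  reflect [/\ g \in B, (X :^ g)%g = X & bact HH chi (1, g)%g = chi]
          (g \in stab HH B X chi).
Proof.
rewrite inE; apply: (iffP and3P) => [[Bg /eqP Xg /eqP chig]|[Bg -> ->]];
  by split=> //.
Qed.

Lemma HstabP B X chi (a : hT * gT) :
  reflect [/\ a.2 \in B, (X :^ a.2)%g = X & bact HH chi a = chi]
          (a \in Hstab HH B X chi).
Proof.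
rewrite !inE; apply: (iffP and3P) => [[Ba /eqP Xa /eqP chia]|[Ba -> ->]];
  by split=> //.
Qed.

Lemma stab_Hstab B X chi g :
  (g \in stab HH B X chi) = ((1, g)%g \in Hstab HH B X chi).
Proof. by apply/stabP/HstabP. Qed.

Lemma stab_group_set (B : {group gT}) X chi : group_set (stab HH B X chi).
Proof.
apply/group_setP; split=> [|g h].
  by apply/stabP; rewrite conjsg1 group1 bact1.
move=> /stabP[Bg Xg cg] /stabP[Bh Xh ch]; apply/stabP; split.
- exact: groupM.
- by rewrite conjsgM Xg.
have -> : ((1, g * h) = (1, g) * (1, h) :> hT * gT)%g.
  by congr (_, _); rewrite mulg1.
by rewrite -bactM cg.
Qed.

Canonical stab_group (B : {group gT}) X chi := Group (stab_group_set B X chi).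

(** If [(s, g)] fixes [chi], then [g] acts on [chi] as [s^-1] does, so [g] already lies in the orbit
    stabilizer. *)
Lemma Hstab_orbstab B X chi :
  Hstab HH (orbstab HH B X chi) X chi = Hstab HH B X chi.
Proof.
apply/setP => a; apply/HstabP/HstabP => [][aB Xa chia]; split=> //.
  by move: aB; rewrite inE => /andP[].
rewrite inE aB Xa eqxx /=; apply/existsP; exists (a.1^-1)%g; apply/eqP.
have -> : ((1, a.2) = a * (a.1^-1, 1) :> hT * gT)%g.
  by case: (a) => s g; congr (_, _); rewrite /= ?mulgV ?mulg1.
by rewrite -bactM chia.
Qed.

Lemma stab_orbstab B X chi : stab HH (orbstab HH B X chi) X chi = stab HH B X chi.
Proof. by apply/setP => g; rewrite !stab_Hstab Hstab_orbstab. Qed.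

Lemma Hstab_norm (B : {group gT}) X chi b :
  b \in Hstab HH B X chi -> b.2 \in 'N(stab HH B X chi).
Proof.
move=> /HstabP[Bb Xb chib]; rewrite inE.
apply/subsetP => _ /imsetP[g /stabP[Bg Xg chig] ->].
have Xb' : (X :^ b.2^-1)%g = X by rewrite -{1}Xb conjsgK.
rewrite conjgE; apply/stabP; split; first by rewrite -conjgE groupJ.
  by rewrite !conjsgM Xb' Xg.
have -> : ((1, b.2^-1 * (g * b.2)) = b^-1 * ((1, g) * b) :> hT * gT)%g.
  by case: (b) => s h; congr (_, _); rewrite /= mul1g mulVg.
have chib' : bact HH chi b^-1%g = chi by rewrite -{1}chib bactM mulgV bact1.
by rewrite -!bactM chib' chig.
Qed.

Lemma stab_brauer_Ind (G N K : {group gT}) chi theta g :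
  G \subset 'N(N) -> brauer_Ind N K chi = theta ->
  g \in stab HH G K chi -> g \in stab HH G N theta.
Proof.
move=> nNG <- /stabP[Gg Kg chig]; have nNg := subsetP nNG g Gg.
apply/stabP; split=> //; first exact: normP.
apply/ffunP => x; rewrite bact1E !ffunE; congr (_ * _).
rewrite (reindex_inj (conjg_inj (g^-1)%g)) /=; apply: eq_big => h.
  by rewrite memJ_norm ?groupV.
by rewrite -conjJg -bact1E chig.
Qed.

Lemma brauer_Ind_stab (N K : {group gT}) chi theta g :
  brauer_Ind N K chi = theta -> g \in N -> bact HH theta (1, g)%g = theta.
Proof.
move=> <- Ng; apply/ffunP => x; rewrite bact1E !ffunE; congr (_ * _).
rewrite (reindex_inj (mulgI g)) /=; apply: eq_big => h; first by rewrite groupMl.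
by rewrite conjgM conjgKV.
Qed.

End Stabilizers.

(** * Induced projective representations *)

Section InducedAssociated.

Variables (p : nat) (S : modular_system p) (hT : finGroupType).
Variables (HH : automorphism_group S hT) (gT : finGroupType).
Variables (N I K J : {group gT}) (chi : brauer_fun S gT) (n k : nat).
Variables (P : gT -> 'M[pmF S]_n) (alpha : gT -> gT -> pmF S) (t : 'I_k -> gT).
Hypotheses (nNJ : J \subset 'N(N)) (defJ : J = (N * I)%g :> {set gT})
           (defK : N :&: I = K) (Tt : left_transversal N K t)
           (assocP : associated I K chi P alpha).
Local Notation R := (indmx I P t t).

Let sIJ : I \subset J. Proof. by rewrite defJ mulG_subr. Qed.
Let sNJ : N \subset J. Proof. by rewrite defJ mulG_subl. Qed.
Let sKN : K \subset N. Proof. by rewrite -defK subsetIl. Qed.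

Lemma indmx_restr : {in N, forall x, R x = indmx K P t t x}.
Proof.
move=> x Nx; have [tN _ _] := Tt; apply: eq_mxblock => i j.
have Ng : ((t i)^-1 * x * t j)%g \in N by rewrite !groupM ?groupV.
by rewrite -defK in_setI Ng.
Qed.

(** Three transversals are allowed so that a factor taken at 1 changes the basis. *)
Lemma indmx_mulr (u v w : 'I_k -> gT) x y :
  left_transversal N K u -> left_transversal N K v -> left_transversal N K w ->
  x \in J -> y \in N ->
  indmx I P u v x *m indmx I P v w y = indmx I P u w (x * y)%g.
Proof.
move=> Tu Tv Tw Jx Ny; have [_ _ _ PM] := assocP.
rewrite (indmx_mul nNJ defJ defK (c := 1)) ?scale1r // ?(subsetP sNJ) //.
move=> a b Ia Ib _; rewrite lcoset_id // scale1r => Nb.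
by rewrite (PM b a _ Ia).1 // -defK inE Nb.
Qed.

Lemma indmx_mull (u v w : 'I_k -> gT) x y :
  left_transversal N K u -> left_transversal N K v -> left_transversal N K w ->
  x \in N -> y \in J ->
  indmx I P u v x *m indmx I P v w y = indmx I P u w (x * y)%g.
Proof.
move=> Tu Tv Tw Nx Jy; have [_ _ _ PM] := assocP.
rewrite (indmx_mul nNJ defJ defK (c := 1)) ?scale1r // ?(subsetP sNJ) //.
move=> a b Ia Ib; rewrite lcoset_id // scale1r => Na _.
by rewrite (PM a b _ Ib).2 // -defK inE Na.
Qed.

Lemma indmx_transversal1 (u : 'I_k -> gT) :
  left_transversal N K u -> indmx I P u u 1 = 1%:M.
Proof. by move=> Tu; have [[P1 _ _] _ _ _] := assocP; apply: (indmx1 defK). Qed.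

Lemma indmx_restr_repr : mx_repr N R.
Proof.
split=> [|x y Nx Ny]; first exact: indmx_transversal1.
by rewrite indmx_mull // (subsetP sNJ).
Qed.

Lemma associated_indmx (beta : gT -> gT -> pmF S) :
  (forall x, x \in N -> p^'.-elt x ->
     exists2 z : pmO S,
       #[x].-primitive_root z & #[x].-primitive_root (pm_red S z)) ->
  (forall x y, x \in J -> y \in J -> beta x y != 0) ->
  (forall x y a b, x \in J -> y \in J -> a \in I -> b \in I ->
     a \in (x *: N)%g -> b \in (y *: N)%g -> alpha a b = beta x y) ->
  associated J N (brauer_Ind N K chi) R beta.
Proof.
move=> lift_root beta0 alphaE.
have [[P1 uP alphaP] reprP affP PM] := assocP.
have RM x y : x \in J -> y \in J -> R x *m R y = beta x y *: R (x * y)%g.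
  move=> Jx Jy; apply: (indmx_mul nNJ defJ defK) => // a b Ia Ib xa yb.
  by rewrite -(alphaE x y a b) //; case: (alphaP a b).
split; last by move=> x g Nx Jg; rewrite indmx_mulr // indmx_mull.
- split; first exact: indmx_transversal1.
    move=> x Jx; have := RM x x^-1%g Jx; rewrite groupV => /(_ Jx).
    rewrite mulgV indmx_transversal1 //.
    move/(congr1 (GRing.scale (beta x x^-1%g)^-1)).
    rewrite scalerA mulVf ?beta0 ?groupV // scale1r scalemxAr.
    by case/mulmx1_unit.
  by move=> x y Jx Jy; rewrite beta0 // RM.
- exact: indmx_restr_repr.
have [aff1 aff2] := affords_indmx sKN reprP affP Tt lift_root.
by split=> // x Nx; rewrite indmx_restr //; apply: aff1.
Qed.

(** Conjugation by [a = b m] turns [P] into [P^b] and the transversal [t] into [u]. Copies of [W] on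
    the diagonal replace [P^b] by a multiple of [P], and the change of basis [V] leads from [u] back
    to [t]. The multiplier at [x] is [mu] at a representative [h x] in [I] of the coset [x N]. *)
Lemma is_mu_indmx (h : gT -> gT) (mu : gT -> pmF S) (a b : hT * gT) m :
  (forall x, x \in J -> h x \in I /\ h x \in (x *: N)%g) ->
  (forall x y, y \in N -> h (x * y)%g = h x) ->
  m \in N -> b.2 \in 'N(N) -> b.2 \in 'N(I) -> a = (b.1, b.2 * m)%g ->
  is_mu HH I K P b mu ->
  is_mu HH J N R a (fun x => mu (h x)).
Proof.
move=> hP hN Nm nNb nIb -> [mu0 muK [W uW simP]]; have [tN tinj tsurj] := Tt.
have Nh x : x \in J -> h x \in I by move/hP => [].
split=> [x Jx|x y Jx Ny|]; [exact/mu0/Nh | by rewrite hN |].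
pose u i := (m^-1 * t i ^ b.2)%g.
have nKb : b.2 \in 'N(K).
  by rewrite -defK -sub1set normsI ?sub1set.
have invMK (c d e : gT) : ((m^-1 * c)^-1 * d * (m^-1 * e) = c^-1 * d ^ m^-1 * e)%g.
  by rewrite conjgE !invMg !invgK !mulgA.
have Tu : left_transversal N K u.
  split=> [i | i j | g Ng]; first by rewrite groupM ?groupV // memJ_norm.
    rewrite -[_^-1%g]mulg1 invMK conj1g mulg1 -conjVg -conjMg memJ_norm //.
    exact: tinj.
  have [|i Ki] := tsurj ((m * g) ^ b.2^-1)%g.
    by rewrite memJ_norm ?groupV ?groupM.
  exists i; rewrite -(memJ_norm _ (groupVr nKb)) -[g](mulKg m).
  rewrite -[_^-1%g]mulg1 invMK conj1g mulg1 conjMg -conjVg conjgK.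
  exact: Ki.
pose D := \mxdiag_(i < k) W; pose V := indmx I P t u 1.
have VV : indmx I P u t 1 *m V = 1%:M.
  by rewrite indmx_mull // ?mulg1 ?indmx_transversal1 // (subsetP sNJ).
have [uV' uV] := mulmx1_unit VV.
have uD : D \in unitmx by apply: unitmx_mxdiag.
have uT : V *m D \in unitmx by rewrite unitmx_mul uV uD.
exists (V *m D) => // x Jx.
pose Q := proj_act HH P b.
have RaE : proj_act HH R (b.1, b.2 * m)%g x = indmx I Q u u x.
  rewrite /proj_act /= invMg conjgM indmx_conj //.
  apply: eq_mxblock => i j.
  by rewrite invMK.
have DQ : D *m indmx I Q u u x = mu (h x) *: (indmx I P u u x *m D).
  apply: (indmx_similar nNJ Tu Jx) => g Ig xg.
  have [Ih xh] := hP x Jx.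
  rewrite [Q g]simP // -mulmxA mulKVmx // -scalemxAl; congr (_ *: _).
  rewrite -[g](mulKVg (h x)) muK // -defK in_setI (groupM (groupVr Ih) Ig) andbT.
  by rewrite -mem_lcoset (lcoset_eqP xh).
have RuuE : V *m indmx I P u u x = R x *m V.
  by rewrite indmx_mull // mul1g indmx_mulr // mulg1.
rewrite RaE -[LHS](mulKmx uT) -[RHS]mulmxA; congr (invmx _ *m _).
rewrite -mulmxA DQ -scalemxAr mulmxA RuuE.
by rewrite -scalemxAl mulmxA.
Qed.

Lemma indmx_class_sum (D : {set gT}) (rN : mx_repr N R) z :
  mx_absolutely_irreducible (MxRepresentation rN) ->
  D \subset J -> {in N, forall x, (D :^ x)%g = D} ->
  \sum_(y in D :&: I) P y = z%:M -> \sum_(y in D) R y = z%:M.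
Proof.
move=> absR sDJ nDN sumP; have [tN _ _] := Tt.
have /is_scalar_mxP[w sumR] : is_scalar_mx (\sum_(y in D) R y).
  apply: (mx_abs_irr_cent_scalar absR); apply/centgmxP => x Nx /=.
  rewrite mulmx_suml mulmx_sumr (reindex_inj (conjg_inj (x^-1)%g)) /=.
  have inD y : (y ^ x^-1 \in D)%g = (y \in D) by rewrite -mem_conjg nDN.
  apply: eq_big => // y; rewrite inD => Dy; have Jy := subsetP sDJ y Dy.
  have JyV : (y ^ x^-1)%g \in J by rewrite groupJ // groupV (subsetP sNJ).
  rewrite indmx_mulr // indmx_mull //.
  by rewrite conjgE invgK mulgA mulgKV.
have [d_gt0 _] := andP absR; rewrite sumR.
(* Absolute irreducibility includes positive degree, so there is a diagonal entry at which to
   compare [w] and [z]. *)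
have /andP[k_gt0 n_gt0] : (0 < k)%N && (0 < n)%N.
  by move: d_gt0; rewrite sum_nat_const card_ord muln_gt0.
pose i0 := Ordinal k_gt0.
have: \sum_(y in D) R y = \mxblock_(i < k, j < k)
    (if i == j then conform_mx 0 (w%:M : 'M_n) else 0).
  by rewrite sumR -mxdiagZ.
rewrite -mxblock_sum => /eq_mxblockP/(_ i0 i0); rewrite eqxx conform_mx_id.
(* Conjugation by [t i0] permutes [D], so this block is the sum of [P] over [D :&: I]. *)
rewrite (reindex_inj (conjg_inj (t i0)^-1%g)) /=.
rewrite (eq_bigr (fun y => if y \in I then P y else 0)) => [|y _]; last first.
  by rewrite conjgE invgK !mulgA mulVg mul1g mulgKV.
have inD y : (y ^ (t i0)^-1 \in D)%g = (y \in D) by rewrite -mem_conjg nDN.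
rewrite -big_mkcondr (eq_bigl [in D :&: I]) /= => [|y]; last by rewrite inD in_setI.
rewrite sumP => /matrixP/(_ (Ordinal n_gt0) (Ordinal n_gt0)).
by rewrite !mxE eqxx !mulr1n => ->.
Qed.

End InducedAssociated.

(** * Conjugacy classes and class sums *)

Lemma class_join_cycle (gT : finGroupType) (K : {group gT}) x :
  x \in 'N(K) -> (x ^: <<x |: K>> = x ^: K)%g.
Proof.
move=> nKx; have -> : (<<x |: K>> = <[x]> * K)%g.
  by rewrite -norm_joinEl ?cycle_subG // /cycle joing_idl.
apply/setP => y; apply/imsetP/imsetP => [[_ /mulsgP[a b xa Kb ->] ->]|[b Kb ->]].
  exists b => //; rewrite conjgM; congr (_ ^ _)%g.
  by case/cycleP: xa => i ->; rewrite conjgE -expgS expgSr mulKg.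
by exists b => //; rewrite -[b]mul1g mem_mulg.
Qed.

(** [D] is a union of [K]-classes; they are split off one at a time, and the scalars add up in the
    same way for [P] and [P']. *)
Lemma class_sums_scalar (F : fieldType) (gT : finGroupType) (K : {group gT})
    (X D : {set gT}) n m (P : gT -> 'M[F]_n) (P' : gT -> 'M[F]_m) :
  {in K, forall x, (D :^ x)%g = D} ->
  (forall x, x \in D -> exists z : F,
     \sum_(y in (x ^: K)%g) P y = z%:M
     /\ \sum_(y in (x ^: K)%g :&: X) P' y = z%:M) ->
  exists z : F, \sum_(y in D) P y = z%:M /\ \sum_(y in D :&: X) P' y = z%:M.
Proof.
elim: {D}_.+1 {-2}D (ltnSn #|D|) => // d IHd D leD KD clD.
have [->|[x Dx]] := set_0Vmem D.
  by exists 0; rewrite set0I !big_set0 !raddf0.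
have sCD : (x ^: K)%g \subset D.
  by apply/subsetP => _ /imsetP[y Ky ->]; rewrite -(KD y Ky) memJ_conjg.
have [||| z [zP zP']] := IHd (D :\: (x ^: K)%g).
- rewrite -ltnS (leq_trans _ leD) // ltnS proper_card //; apply/properP.
  by split; [exact: subsetDl | exists x; rewrite // inE class_refl].
- move=> y Ky; rewrite conjDg KD //; congr (_ :\: _).
  by apply/normP; rewrite (subsetP (class_norm x K)).
- by move=> y /setDP[Dy _]; apply: clD.
have [w [wP wP']] := clD x Dx; exists (w + z).
rewrite !raddfD /= -zP -zP' -wP -wP'; split.
  by rewrite (big_setID (x ^: K)%g) /= (setIidPr sCD).
rewrite (big_setID (x ^: K)%g) /= setIAC (setIidPr sCD).
by rewrite setIDAC.
Qed.

(** * Transfer of the order relation to the induced triples *)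

Theorem theorem5p1 (p : nat) (S : modular_system p)
    (hT : finGroupType) (HH : automorphism_group S hT)
    (gT : finGroupType) (G N H M K Z : {group gT})
    (theta phi chi lambda : brauer_fun S gT) (star : order_kind) :
  splits_over_KF S G ->
  H_triple HH G N theta -> H_triple HH H M phi ->
  G = (N * H)%g :> {set gT} -> N :&: H = M :> {set gT} ->
  Hstab HH H N theta = Hstab HH H M phi ->
  K \subset N -> Z \subset M -> Z = K :&: H :> {set gT} ->
  IBr K chi -> IBr Z lambda ->
  brauer_Ind N K chi = theta -> brauer_Ind M Z lambda = phi ->
  stab HH N K chi = K -> stab HH M Z lambda = Z ->
  triple_ge HH star (orbstab_group HH G K chi) K chi
                    (orbstab_group HH H Z lambda) Z lambda ->
  Hstab HH H M phi = (Hstab HH H Z lambda * setX 1 M)%g ->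
  triple_ge HH star G N theta H M phi.
Proof.
move=> splitG tripG tripH defG defM eqNM sKN sZM defZ irrK irrZ IndK IndZ.
move=> stabK stabZ [_ _ _ eqKZ [n [m [P [P' geP]]]]] defHphi.
have [sNG irrN orbG] := tripG; have [sMH irrM orbH] := tripH.
have sHG : H \subset G by rewrite defG mulG_subr.
have sMN : M \subset N by rewrite -defM subsetIl.
have nNG : G \subset 'N(N).
  by apply/subsetP => g; rewrite {1}orbG inE => /and3P[_ /eqP Ng _]; apply/normP.
have nMH : H \subset 'N(M).
  by apply/subsetP => g; rewrite {1}orbH inE => /and3P[_ /eqP Mg _]; apply/normP.
pose I := stab_group HH G K chi; pose I' := stab_group HH H Z lambda.
pose J := stab_group HH G N theta; pose J' := stab_group HH H M phi.
rewrite [Hstab _ _ Z lambda]Hstab_orbstab in eqKZ.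
have inI' g : g \in I' -> g \in I.
  rewrite [_ \in I']stab_Hstab -eqKZ => /HstabP[/= L'g Kg chig].
  apply/stabP; split=> //; apply: (subsetP sHG).
  by move: L'g; rewrite inE => /andP[].
have sI'I : I' \subset I by apply/subsetP.
(* With [sI'I] and [sI'L'], this makes [I'] the intersection of [I] and the orbit stabilizer of
   [lambda] in [H]. *)
have II' g : g \in I -> g \in orbstab HH H Z lambda -> g \in I'.
  move=> /stabP[Gg Kg chig] L'g; rewrite [_ \in I']stab_Hstab -eqKZ.
  exact/HstabP.
have sI'L' : I' \subset orbstab HH H Z lambda.
  apply/subsetP => g; rewrite [_ \in I']stab_Hstab -eqKZ.
  by case/HstabP.
have sI'H : I' \subset H by apply/subsetP => g /stabP[].
have sIG : I \subset G by apply/subsetP => g /stabP[].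
have defK : N :&: I = K.
  rewrite -[RHS]stabK; apply/setP => g; rewrite inE.
  apply/andP/stabP => [[Ng /stabP[_ Kg chig]]|[Ng Kg chig]] //.
  by split=> //; apply/stabP; rewrite (subsetP sNG).
have defZ' : M :&: I' = Z.
  rewrite -[RHS]stabZ; apply/setP => g; rewrite inE.
  apply/andP/stabP => [[Ng /stabP[_ Kg chig]]|[Ng Kg chig]] //.
  by split=> //; apply/stabP; rewrite (subsetP sMH).
have sJG : J \subset G by apply/subsetP => g /stabP[].
have sJH : J' \subset H by apply/subsetP => g /stabP[].
have nNJ : J \subset 'N(N) := subset_trans sJG nNG.
have nMJ : J' \subset 'N(M) := subset_trans sJH nMH.
have sNJ : N \subset J.
  apply/subsetP => g Ng; apply/stabP.
  by rewrite (subsetP sNG) // conjGid // (brauer_Ind_stab HH IndK Ng).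
have sMJ : M \subset J'.
  apply/subsetP => g Mg; apply/stabP.
  by rewrite (subsetP sMH) // conjGid // (brauer_Ind_stab HH IndZ Mg).
have sIJ : I \subset J.
  by apply/subsetP => g; apply: stab_brauer_Ind.
have sIJ' : I' \subset J'.
  by apply/subsetP => g; apply: stab_brauer_Ind.
(* The factorization [defHphi], read at elements whose first component is trivial. *)
have defJ' : J' = (M * I')%g :> {set gT}.
  apply/eqP; rewrite eqEsubset mul_subG // andbT.
  rewrite -(normC (subset_trans sI'H nMH)).
  apply/subsetP => g; rewrite [_ \in J']stab_Hstab defHphi.
  case/mulsgP=> [[s h] [s' y] Ib]; rewrite inE => /andP[/set1P/= -> My] [].
  rewrite mulg1 => s1 ->; apply: mem_mulg => //.
  by rewrite [_ \in I']stab_Hstab s1.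
have sJJ : J' \subset J.
  apply/subsetP => g J'g; have := J'g; rewrite [_ \in J']stab_Hstab -eqNM.
  by case/HstabP => /= Hg Ng thg; apply/stabP; rewrite (subsetP sHG).
(* Since [G = N H], an element of [J] is a product of an element of [N] and one of [J :&: H]; the
   latter lies in [J'] because [theta] and [phi] have the same stabilizer over [H]. *)
have sJNI' : J \subset (N * I')%g.
  apply/subsetP => g Jg; have := subsetP sJG g Jg; rewrite defG.
  case/mulsgP => y h Ny Hh defg; have Jh : h \in J.
    by rewrite -(groupMl _ (subsetP sNJ y Ny)) -defg.
  have : h \in J'.
    rewrite [_ \in J']stab_Hstab -eqNM; apply/HstabP.
    by have /stabP[_ Nh thh] := Jh.
  rewrite defJ' defg => /mulsgP[y' i My' Ii ->].
  by rewrite mulgA mem_mulg // groupM // (subsetP sMN).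
have defJ : J = (N * I)%g :> {set gT}.
  apply/eqP; rewrite eqEsubset mul_subG // andbT.
  by apply: subset_trans sJNI' _; rewrite mulgS.
(* The representative of [x N] is taken in [I'], not just in [I], so that both induced maps get the
   same factor set; [repr] makes it depend only on the coset. *)
pose h x := repr ((x *: N)%g :&: I').
have hP x : x \in J -> h x \in I' /\ h x \in (x *: N)%g.
  move=> Jx; have /mulsgP[y i Ny Ii defx] := subsetP sJNI' x Jx.
  suff: h x \in ((x *: N)%g :&: I') by case/setIP.
  apply: (mem_repr i); rewrite inE Ii andbT mem_lcoset.
  have -> : i = (y^-1 * x)%g by rewrite defx mulKg.
  by rewrite -/(conjg _ _) memJ_norm ?groupV // (subsetP nNJ).
have h_coset x y : y \in N -> h (x * y)%g = h x.
  by move=> Ny; rewrite /h lcosetM lcoset_id.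
have givesP : gives HH (orbstab_group HH G K chi) K chi
                       (orbstab_group HH H Z lambda) Z lambda P P'.
  by case: (star) geP => // [[]|[[]]].
have [alpha [alpha' []]] := givesP; rewrite /= !stab_orbstab.
move=> assocP assocP' alphaE muE.
pose beta x y := alpha' (h x) (h y).
have IK x a : x \in J -> a \in I -> a \in (x *: N)%g -> a \in (h x *: K)%g.
  move=> /hP[Ih xh] Ia xa; rewrite mem_lcoset -defK in_setI.
  rewrite (groupM (groupVr (inI' _ Ih)) Ia) andbT.
  by rewrite -mem_lcoset (lcoset_eqP xh).
have hM x : x \in J' -> h x \in (x *: M)%g.
  move=> J'x; have [Ih xh] := hP x (subsetP sJJ x J'x).
  rewrite mem_lcoset -defM in_setI -mem_lcoset xh groupM ?groupV //.
    exact: (subsetP sJH).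
  exact: (subsetP sI'H).
have betaE x y a b : x \in J -> y \in J -> a \in I -> b \in I ->
    a \in (x *: N)%g -> b \in (y *: N)%g -> alpha a b = beta x y.
  move=> Jx Jy Ia Ib xa yb; apply: alphaE => //.
  + by case: (hP x Jx).
  + by case: (hP y Jy).
  + exact: IK.
  exact: IK.
have betaE' x y a b : x \in J' -> y \in J' -> a \in I' -> b \in I' ->
    a \in (x *: M)%g -> b \in (y *: M)%g -> alpha' a b = beta x y.
  move=> J'x J'y Ia Ib xa yb.
  have [Jx Jy] := (subsetP sJJ x J'x, subsetP sJJ y J'y).
  have [[Ihx xh] [Ihy yh]] := (hP x Jx, hP y Jy).
  have sMl z : (z *: M)%g \subset (z *: N)%g by rewrite mulgS.
  (* On [I'] the factor sets [alpha] and [alpha'] agree, which reduces the claim to the one for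
     [I]. *)
  rewrite -(alphaE a b a b) ?lcoset_refl ?inI' //.
  by apply: betaE; rewrite ?inI' // (subsetP (sMl _)).
have beta0 x y : x \in J -> y \in J -> beta x y != 0.
  move=> /hP[Ihx _] /hP[Ihy _]; have [[_ _ a0] _ _ _] := assocP'.
  by case: (a0 _ _ Ihx Ihy).
have lift_root x : x \in N -> (p^'.-elt x)%g -> exists2 z : pmO S,
    (#[x]%g).-primitive_root z & (#[x]%g).-primitive_root (pm_red S z).
  move=> Nx; apply: (splits_primitive_root splitG).
  by rewrite cycle_subG (subsetP sNG).
have [k [t Tt]] := left_transversal_exists sKN.
have [k' [t' Tt']] := left_transversal_exists sZM.
have assocR := associated_indmx nNJ defJ defK Tt assocP lift_root beta0 betaE.
have assocR' : associated J' M (brauer_Ind M Z lambda) (indmx I' P' t' t') beta.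
  apply: (associated_indmx nMJ defJ' defZ' Tt' assocP' _ _ betaE').
    by move=> x Mx; apply: lift_root; apply: (subsetP sMN).
  by move=> x y J'x J'y; apply: beta0; apply: (subsetP sJJ).
rewrite IndK in assocR; rewrite IndZ in assocR'.
have givesR : gives HH G N theta H M phi (indmx I P t t) (indmx I' P' t' t').
  exists beta, beta; split=> //.
    move=> x y u v _ _ _ _ /lcoset_eqP xu /lcoset_eqP yv.
    by rewrite /beta /h xu yv.
  (* [a = b * (1, y)] with [b] fixing [lambda], hence [chi], and [y] in [M]; the multipliers of [b],
     evaluated at the representatives, serve for [a]. *)
  move=> a; rewrite eqNM defHphi => /mulsgP[b [s y] HSb].
  rewrite inE => /andP[/set1P/= -> My] ->.
  have /HstabP[Hb Zb lb] := HSb.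
  have [|mu [mu' [mu_b mu'_b mu_eq]]] := muE b.
    by rewrite /= eqKZ.
  exists (fun x => mu (h x)), (fun x => mu' (h x)); split.
  - apply: (is_mu_indmx nNJ defJ defK Tt assocP (b := b) (m := y)) => //.
    + by move=> x /hP[/inI'].
    + exact: (subsetP sMN).
    + by apply: (subsetP nNG); apply: (subsetP sHG).
    + apply: Hstab_norm.
      move: HSb; rewrite -eqKZ => /HstabP[L'b Kb chib]; apply/HstabP; split=> //.
      exact: (subsetP sHG).
    by congr (_, _); rewrite mulg1.
  - apply: (is_mu_indmx nMJ defJ' defZ' Tt' assocP' (b := b) (m := y)) => //.
    + move=> x J'x; split; last exact: hM.
      by case: (hP x (subsetP sJJ x J'x)).
    + by move=> x z Mz; apply: h_coset; apply: (subsetP sMN).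
    + exact: (subsetP nMH).
    + exact: Hstab_norm.
    by congr (_, _); rewrite mulg1.
  by move=> x J'x; apply: mu_eq; case: (hP x (subsetP sJJ x J'x)).
split=> //; exists _, _, (indmx I P t t), (indmx I' P' t' t').
have cP : gives_c HH (orbstab_group HH G K chi) K chi
             (orbstab_group HH H Z lambda) Z lambda P P' ->
    gives_c HH G N theta H M phi (indmx I P t t) (indmx I' P' t' t').
  move=> [_ sCL' scalP].
  (* An element centralizing [N] centralizes [K]; it fixes [chi], which vanishes off [K]. *)
  have CI c : c \in 'C_G(N)%g -> c \in I /\ c \in 'C_(orbstab HH G K chi)(K)%g.
    move=> /setIP[Gc cNc]; have cKc := subsetP (centS sKN) c cNc.
    have [_ _ [_ chi0] _] := assocP.
    have nKc : c \in 'N(K) := subsetP (cent_sub K) c cKc.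
    have Ic : c \in I.
      apply/stabP; split=> //; first exact: normP.
      apply/ffunP => x; rewrite bact1E; have [Kx|nKx] := boolP (x \in K).
        by rewrite conjgE invgK mulgA (centP cKc x Kx) mulgK.
      by rewrite !chi0 ?(negPf nKx) // memJ_norm ?groupV // (negPf nKx).
    split=> //; rewrite inE cKc andbT; move: Ic.
    by rewrite [_ \in I]stab_Hstab -(Hstab_orbstab HH G) => /HstabP[].
  have CI' c : c \in 'C_G(N)%g -> c \in I'.
    by move=> /CI[Ic cLc]; apply: II' => //; apply: (subsetP sCL').
  split=> // [|c cNc].
    by apply/subsetP => c /CI' Ic; apply: (subsetP sI'H).
  have [Ic cLc] := CI c cNc; have [z [Pc P'c]] := scalP c cLc.
  have /setIP[_ cN] := cNc.
  exists z; split; first exact: (indmx_central defK Tt Ic cN Pc).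
  apply: (indmx_central defZ' Tt' (CI' c cNc) _ P'c).
  exact: (subsetP (centS sMN)).
have bP : gives_b HH (orbstab_group HH G K chi) K chi
             (orbstab_group HH H Z lambda) Z lambda P P' ->
    gives_b HH G N theta H M phi (indmx I P t t) (indmx I' P' t' t').
  move=> [/cP cR sumP]; split=> // x Jx.
  rewrite /= class_join_cycle ?(subsetP nNJ) //.
  set C := (x ^: N)%g.
  have CN y : y \in N -> (C :^ y)%g = C.
    by move=> Ny; apply/normP; rewrite (subsetP (class_norm x N)).
  have sCJ : C \subset J.
    by apply/subsetP => _ /imsetP[y Ny ->]; rewrite groupJ // (subsetP sNJ).
  have nKI : I \subset 'N(K) by rewrite -defK normsI ?normG // (subset_trans sIG).
  (* [C :&: I] is a union of [K]-classes, and on each of them the block condition provides a scalar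
     common to [P] and [P']. *)
  have [||z [sumI sumI']] := @class_sums_scalar _ _ K (orbstab HH H Z lambda)
      (C :&: I) _ _ P P'.
  - move=> y Ky; have Iy : y \in I by move: Ky; rewrite -defK => /setIP[].
    by rewrite conjIg CN ?(subsetP sKN) // conjGid.
  - move=> y /setIP[_ Iy]; have := sumP y; rewrite /= stab_orbstab => /(_ Iy).
    by rewrite class_join_cycle // (subsetP nKI).
  have [_ reprR affR _] := assocR; have [_ reprR' affR' _] := assocR'.
  have [_ splitN] := splitG N sNG.
  have [_ splitM] := splitG M (subset_trans sMH sHG).
  have absR := @affords_IBr_abs_irr _ _ _ _ _ (MxRepresentation reprR) _
    irrN affR splitN.
  have absR' := @affords_IBr_abs_irr _ _ _ _ _ (MxRepresentation reprR') _
    irrM affR' splitM.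
  exists z; split.
    apply: (indmx_class_sum nNJ defJ defK Tt assocP absR) => //.
  apply: (indmx_class_sum nMJ defJ' defZ' Tt' assocP' absR').
  - apply/subsetP => y /setIP[/(subsetP sCJ) Jy Hy].
    rewrite [_ \in J']stab_Hstab -eqNM; apply/HstabP.
    by have /stabP[_ Ny thy] := Jy.
  - by move=> y My; rewrite conjIg CN ?(subsetP sMN) // conjGid // (subsetP sMH).
  (* Both index sets are [C :&: I']. *)
  rewrite -sumI'; apply: eq_bigl => y; rewrite !in_setI -!andbA; congr (_ && _).
  apply/andP/andP => [[_ Iy]|[Iy L'y]].
    by rewrite inI' // (subsetP sI'L').
  by split; [apply: (subsetP sI'H); exact: II' | exact: II'].
by case: (star) geP => //.
Qed.
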